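(* Let $A$ be a $3\times 3$ skew-symmetric integer matrix whose associated quiver is connected, which is mutation-acyclic and mutation-infinite, and let $g\in\mathbb{Z}^3$ be nonzero with $Ag=0$. Then the graded cluster algebra $\mathcal{A}((x_1,x_2,x_3),A,g)$ has infinitely many cluster variables in each occurring degree. Moreover, the grading is balanced.
   Context: Matrix mutation: for a $3\times3$ skew-symmetric integer matrix $B=(b_{ij})$ and $k\in\{1,2,3\}$, $\mu_k(B)=(b'_{ij})$ with $b'_{ij}=-b_{ij}$ if $i=k$ or $j=k$, and $b'_{ij}=b_{ij}+\operatorname{sgn}(b_{ik})\max(b_{ik}b_{kj},0)$ otherwise. The mutation class of $B$ is the set of matrices obtained from $B$ by finite sequences of mutations; $B$ is mutation-infinite if its mutation class is infinite. The quiver of $B$ has $b_{ij}$ arrows $i\to j$ when $b_{ij}>0$; $B$ is acyclic if this quiver has no oriented cycle, and mutation-acyclic if some matrix in its mutation class is acyclic. Graded cluster algebras: a seed $((x_1,x_2,x_3),B)$ mutates in direction $k$ to $(x',\mu_k B)$ with $x'_j=x_j$ ($j\ne k$) and $x'_k=\big(\prod_{b_{ik}>0}x_i^{b_{ik}}+\prod_{b_{ik}<0}x_i^{-b_{ik}}\big)/x_k$. Cluster variables are all entries of clusters reachable by iterated mutation, and $\mathcal{A}(x,B,g)$ is the algebra they generate, graded by $\deg x_i=g_i$ where $Bg=0$; under mutation at $k$ the degree vector becomes $g'$ with $g'_j=g_j$ ($j\neq k$) and $g'_k=-g_k+\sum_{b_{ik}>0}b_{ik}g_i$; every cluster variable is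 homogeneous. A degree occurs if some cluster variable has that degree. The grading is balanced if for every $d$ there is a bijection between the cluster variables of degree $d$ and those of degree $-d$. *)

(* Defs.v *)
From HB Require Import structures.
From mathcomp Require Import all_boot all_order all_algebra.
From mathcomp Require Import fraction mpoly.
Set Implicit Arguments. Unset Strict Implicit. Unset Printing Implicit Defensive.
Import Order.TTheory GRing.Theory Num.Theory.
Local Open Scope ring_scope.

Definition skew3 (B : 'M[int]_3) : Prop := B^T = - B.

Definition mut_mx (k : 'I_3) (B : 'M[int]_3) : 'M[int]_3 :=
  \matrix_(i, j) if (i == k) || (j == k) then - B i j
                 else B i j + Num.sg (B i k) * Num.max (B i k * B k j) 0.

Definition mut_seq (s : seq 'I_3) (B : 'M[int]_3) : 'M[int]_3 :=
  foldl (fun M k => mut_mx k M) B s.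

Definition arrow (B : 'M[int]_3) : rel 'I_3 := fun i j => 0 < B i j.

Definition quiver_connected (B : 'M[int]_3) : Prop :=
  forall i j : 'I_3, connect (fun a b => B a b != 0) i j.

Definition acyclic (B : 'M[int]_3) : Prop :=
  ~ (exists i j : 'I_3, arrow B i j /\ connect (arrow B) j i).

Definition mutation_acyclic (B : 'M[int]_3) : Prop :=
  exists s : seq 'I_3, acyclic (mut_seq s B).

Definition mutation_infinite (B : 'M[int]_3) : Prop :=
  ~ (exists l : seq 'M[int]_3, forall s : seq 'I_3, mut_seq s B \in l).

(** Ambient field of rational functions Q(x1,x2,x3) (fraction field of Z[x1,x2,x3]). *)
Definition F : Type := {fraction {mpoly int[3]}}.

Record gseed := GSeed { sx : 'I_3 -> F; sB : 'M[int]_3; sg : 'I_3 -> int }.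

Definition mut_seed (k : 'I_3) (S : gseed) : gseed :=
  let x := sx S in let B := sB S in let g := sg S in
  GSeed
    (fun j => if j == k then
        ((\prod_(i < 3 | 0 < B i k) x i ^+ `|B i k|%N)
         + (\prod_(i < 3 | B i k < 0) x i ^+ `|B i k|%N)) / x k
      else x j)
    (mut_mx k B)
    (fun j => if j == k then
        - g k + \sum_(i < 3 | 0 < B i k) B i k * g i
      else g j).

Definition mut_seed_seq (s : seq 'I_3) (S : gseed) : gseed :=
  foldl (fun T k => mut_seed k T) S s.

Definition init_seed (B : 'M[int]_3) (g : 'cV[int]_3) : gseed :=
  GSeed (fun i => @FracField.tofrac {mpoly int[3]} 'X_i) B (fun i => g i ord0).

Definition clvar_of_deg (B : 'M[int]_3) (g : 'cV[int]_3) (d : int) (y : F) : Prop :=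
  exists (s : seq 'I_3) (k : 'I_3),
    sx (mut_seed_seq s (init_seed B g)) k = y /\
    sg (mut_seed_seq s (init_seed B g)) k = d.

Definition degree_occurs (B : 'M[int]_3) (g : 'cV[int]_3) (d : int) : Prop :=
  exists y, clvar_of_deg B g d y.

Definition infinitely_many_of_deg (B : 'M[int]_3) (g : 'cV[int]_3) (d : int) : Prop :=
  forall l : seq F, exists y, clvar_of_deg B g d y /\ y \notin l.

Definition bijection_between (P Q : F -> Prop) : Prop :=
  exists f : F -> F,
    (forall x, P x -> Q (f x)) /\
    (forall x1 x2, P x1 -> P x2 -> f x1 = f x2 -> x1 = x2) /\
    (forall y, Q y -> exists x, P x /\ f x = y).

Definition balanced (B : 'M[int]_3) (g : 'cV[int]_3) : Prop :=
  forall d : int, bijection_between (clvar_of_deg B g d) (clvar_of_deg B g (- d)).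

(* Main.v *)
Require Import Defs.
From HB Require Import structures.
From mathcomp Require Import all_boot all_order all_algebra.
From mathcomp Require Import fraction mpoly realalg.
From mathcomp Require Import ring lra zify.
From Stdlib Require Import FunctionalExtensionality ClassicalEpsilon.
Import Order.TTheory GRing.Theory Num.Theory.
Local Open Scope ring_scope.

(** Tropicalize: a cluster variable is a quotient of polynomials with
    nonnegative coefficients, so each weight vector assigns it a well-defined
    max-plus value, and this value follows the tropical exchange relation.

    Some matrix of the class is acyclic, with quiver 1 -a-> 2 -b-> 3, 1 -c-> 3.
    Mutating at the three successive sources restores the quiver and negates all
    degrees. Substituting the resulting cluster for the initial one therefore
    exchanges the cluster variables of degree d and -d, so the grading is balanced.

    Mutation-infiniteness means C = a^2 + b^2 + c^2 + abc >= 5. The threefold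
    source mutation then has a tropical eigenvector of eigenvalue L > 1, where
    (1 + L)^2 = C L. At this point all cluster variables have positive tropical
    value: mutation either stays on the belt of acyclic quivers or leaves it through
    the middle vertex, and beyond that, apart from pentagons leading back to the
    belt, the values and the arrow multiplicities grow. Iterating the doubled
    source cycle on a cluster variable preserves its degree and multiplies its
    tropical value by L^2, which gives infinitely many variables of each degree. *)

(** * Tropical values and substitution *)

Section TropicalEvaluation.
Context {n : nat} {R : realDomainType}.
Variable w : 'I_n -> R.
Local Notation Zx := {mpoly int[n]}.
Local Notation K := {fraction {mpoly int[n]}}.

Definition weight (m : 'X_{1..n}) : R := \sum_(i < n) w i *+ m i.

Lemma weightD m1 m2 : weight (m1 + m2)%MM = weight m1 + weight m2.
Proof. by rewrite /weight -big_split; apply: eq_bigr => i _; rewrite mnmDE mulrnDr. Qed.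

(** A relation rather than a function: the zero polynomial has no value, and nonnegativity of the
    coefficients is carried along so that sums and products never cancel. *)
Definition trop_poly (p : Zx) (d : R) : Prop :=
  [/\ forall m, 0 <= p@_m,
      exists2 m, p@_m != 0 & weight m = d
    & forall m, p@_m != 0 -> weight m <= d].

Lemma trop_poly_neq0 p d : trop_poly p d -> p != 0.
Proof. by case=> _ [m nz _] _; apply: contraNneq nz => ->; rewrite mcoeff0. Qed.

Lemma trop_poly_unique p d d' : trop_poly p d -> trop_poly p d' -> d = d'.
Proof.
move=> [_ [m nz <-] le1] [_ [m' nz' <-] le2].
by apply/le_anti/andP; split; [exact: le2 | exact: le1].
Qed.

Lemma trop_poly1 : trop_poly 1 0.
Proof.
split=> [m | | m]; first by rewrite mcoeff1; case: eqP.
  exists 0%MM; first by rewrite mcoeff1 eqxx.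
  by rewrite /weight big1 // => i _; rewrite mnm0E.
rewrite mcoeff1; case: (eqVneq m 0%MM) => [-> _|_]; last by rewrite eqxx.
by rewrite /weight big1 // => i _; rewrite mnm0E.
Qed.

Lemma trop_polyX i : trop_poly 'X_i (w i).
Proof.
have wi : weight U_(i)%MM = w i.
  rewrite /weight (bigD1 i) //= mnm1E eqxx big1 ?addr0 // => j /negPf ji.
  by rewrite mnm1E eq_sym ji.
split=> [m | | m]; first by rewrite mcoeffX; case: eqP.
  by exists U_(i)%MM => //; rewrite mcoeffX eqxx.
by rewrite mcoeffX; case: (eqVneq U_(i)%MM m) => [<- _|_]; rewrite ?wi ?eqxx.
Qed.

Lemma trop_polyD p q d e :
  trop_poly p d -> trop_poly q e -> trop_poly (p + q) (Num.max d e).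
Proof.
move=> [p0 [m pm md] pd] [q0 [m' qm' me] qe].
have addn0 m1 : (p@_m1 + q@_m1 == 0) = (p@_m1 == 0) && (q@_m1 == 0).
  by rewrite paddr_eq0.
split=> [m1 | | m1].
- by rewrite mcoeffD addr_ge0.
- case: (leP d e) => _.
    by exists m' => //; rewrite mcoeffD addn0 negb_and qm' orbT.
  by exists m => //; rewrite mcoeffD addn0 negb_and pm.
- rewrite mcoeffD addn0 negb_and le_max.
  by case/orP => [/pd -> | /qe ->]; rewrite ?orbT.
Qed.

(* Nonnegativity of the coefficients excludes cancellation, so the support of
   a product is the full sumset of the supports. *)
Lemma trop_polyM p q d e :
  trop_poly p d -> trop_poly q e -> trop_poly (p * q) (d + e).
Proof.
move=> [p0 [m pm md] pd] [q0 [m' qm' me] qe].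
split=> [m1 | | m1].
- by rewrite mcoeffM sumr_ge0 // => k _; rewrite mulr_ge0.
- exists (m + m')%MM; last by rewrite weightD md me.
  have dm : (mdeg m < (mdeg (m + m')%MM).+1)%N by rewrite ltnS mdegD leq_addr.
  have dm' : (mdeg m' < (mdeg (m + m')%MM).+1)%N by rewrite ltnS mdegD leq_addl.
  rewrite mcoeffM (bigD1 (BMultinom dm, BMultinom dm')) //=.
  rewrite gt_eqF // ltr_wpDr ?sumr_ge0 // => [k _|]; first by rewrite mulr_ge0.
  by rewrite mulr_gt0 // lt_def ?pm ?qm' ?p0 ?q0.
- rewrite -mcoeff_msupp => /msuppM_le /allpairsP [[a b] /= [+ + ->]].
  rewrite !mcoeff_msupp => /pd ? /qe ?.
  by rewrite weightD lerD.
Qed.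

Definition trop (y : K) (d : R) : Prop :=
  exists p q : Zx, exists d1 d2 : R,
    [/\ trop_poly p d1, trop_poly q d2,
        y = FracField.tofrac p / FracField.tofrac q & d = d1 - d2].

Lemma trop_neq0 y d : trop y d -> y != 0.
Proof.
move=> [p [q [d1 [d2 [/trop_poly_neq0 p0 /trop_poly_neq0 q0 -> _]]]]].
by rewrite mulf_neq0 ?invr_eq0 ?tofrac_eq0.
Qed.

(** Cross-multiplying two representations gives one polynomial, whose value is unique and additive
    over products. *)
Lemma trop_unique y d d' : trop y d -> trop y d' -> d = d'.
Proof.
move=> [p [q [d1 [d2 [tp tq -> ->]]]]] [p' [q' [d1' [d2' [tp' tq' e ->]]]]].
have := e => /eqP; rewrite eqr_div ?tofrac_eq0 ?(trop_poly_neq0 _ _ tq)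
  ?(trop_poly_neq0 _ _ tq') // -!tofracM tofrac_eq => /eqP pq.
have := trop_polyM _ _ _ _ tp tq'; rewrite pq => t1.
have := trop_poly_unique _ _ _ t1 (trop_polyM _ _ _ _ tp' tq); lra.
Qed.

Lemma trop1 : trop 1 0.
Proof.
exists 1, 1, 0, 0; split; rewrite ?subr0 ?tofrac1 ?divr1 //; exact: trop_poly1.
Qed.

Lemma tropX i : trop (FracField.tofrac 'X_i) (w i).
Proof.
exists 'X_i, 1, (w i), 0; split; rewrite ?subr0 ?tofrac1 ?divr1 //.
- exact: trop_polyX.
- exact: trop_poly1.
Qed.

Lemma tropM y z d e : trop y d -> trop z e -> trop (y * z) (d + e).
Proof.
move=> [p [q [d1 [d2 [tp tq -> ->]]]]] [p' [q' [d1' [d2' [tp' tq' -> ->]]]]].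
exists (p * p'), (q * q'), (d1 + d1'), (d2 + d2').
split; [exact: trop_polyM | exact: trop_polyM | | by ring].
by rewrite !tofracM mulf_div.
Qed.

Lemma tropV y d : trop y d -> trop y^-1 (- d).
Proof.
move=> [p [q [d1 [d2 [tp tq -> ->]]]]].
by exists q, p, d2, d1; split=> //; rewrite ?opprB // invf_div.
Qed.

Lemma tropD y z d e : trop y d -> trop z e -> trop (y + z) (Num.max d e).
Proof.
move=> [p [q [d1 [d2 [tp tq -> ->]]]]] [p' [q' [d1' [d2' [tp' tq' -> ->]]]]].
exists (p * q' + p' * q), (q * q'), (Num.max (d1 + d2') (d1' + d2)), (d2 + d2').
split; [by apply: trop_polyD; exact: trop_polyM | exact: trop_polyM | |].
  rewrite tofracD !tofracM addf_div ?tofrac_eq0 //.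
    exact: trop_poly_neq0 tq.
  exact: trop_poly_neq0 tq'.
rewrite addr_maxl; congr Num.max; ring.
Qed.

Lemma tropXn y d k : trop y d -> trop (y ^+ k) (d *+ k).
Proof.
move=> ty; elim: k => [|k IH]; first by rewrite expr0 mulr0n; exact: trop1.
by rewrite exprS mulrS; exact: tropM.
Qed.

Lemma trop_prod (I : Type) (r : seq I) (P : pred I) (f : I -> K) (d : I -> R) :
  (forall i, P i -> trop (f i) (d i)) ->
  trop (\prod_(i <- r | P i) f i) (\sum_(i <- r | P i) d i).
Proof.
move=> td; elim/big_ind2: _ => //; first exact: trop1.
by move=> *; exact: tropM.
Qed.

End TropicalEvaluation.

(** * Substitution into rational functions *)

Section Substitution.
Context {D : idomainType} {L : fieldType}.
Variable ev : {rmorphism D -> L}.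

(* The extension of ev to rational functions is partial: related pairs are those
   for which some denominator survives. *)
Definition subst (y : {fraction D}) (z : L) : Prop :=
  exists p q : D, [/\ q != 0, ev q != 0,
    y = FracField.tofrac p / FracField.tofrac q & z = ev p / ev q].

Lemma subst_unique y z z' : subst y z -> subst y z' -> z = z'.
Proof.
move=> [p [q [q0 sq0 -> ->]]] [p' [q' [q0' sq0' + ->]]] => /eqP.
rewrite eqr_div ?tofrac_eq0 // -!tofracM tofrac_eq => /eqP pq.
by apply/eqP; rewrite (eqr_div _ _ sq0 sq0') -!(rmorphM ev) pq.
Qed.

Lemma subst1 : subst 1 1.
Proof.
exists 1, 1; rewrite rmorph1 tofrac1 divr1; split; rewrite ?oner_eq0 ?divr1 //.
Qed.

Lemma subst_frac p : subst (FracField.tofrac p) (ev p).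
Proof. by exists p, 1; rewrite rmorph1 tofrac1 !divr1; split; rewrite ?oner_eq0. Qed.

Lemma substM y z y' z' : subst y z -> subst y' z' -> subst (y * y') (z * z').
Proof.
move=> [p [q [q0 sq0 -> ->]]] [p' [q' [q0' sq0' -> ->]]].
exists (p * p'), (q * q'); split.
- exact: mulf_neq0.
- by rewrite rmorphM; exact: mulf_neq0.
- by rewrite !tofracM mulf_div.
- by rewrite !rmorphM mulf_div.
Qed.

Lemma substD y z y' z' : subst y z -> subst y' z' -> subst (y + y') (z + z').
Proof.
move=> [p [q [q0 sq0 -> ->]]] [p' [q' [q0' sq0' -> ->]]].
exists (p * q' + p' * q), (q * q'); split.
- exact: mulf_neq0.
- by rewrite rmorphM; exact: mulf_neq0.
- by rewrite tofracD !tofracM addf_div ?tofrac_eq0.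
- by rewrite rmorphD !rmorphM (addf_div _ _ sq0 sq0').
Qed.

(** Nonvanishing of [z] says that the evaluated numerator is nonzero, so it may serve as a
    denominator. *)
Lemma substV y z : y != 0 -> z != 0 -> subst y z -> subst y^-1 z^-1.
Proof.
move=> y0 z0 [p [q [q0 sq0 ey ez]]]; exists q, p; split=> //.
- by apply: contraNneq y0 => p0; rewrite ey p0 tofrac0 mul0r.
- by apply: contraNneq z0 => p0; rewrite ez p0 mul0r.
- by rewrite ey invf_div.
- by rewrite ez invf_div.
Qed.

Lemma substXn y z k : subst y z -> subst (y ^+ k) (z ^+ k).
Proof.
move=> s; elim: k => [|k IH]; first by rewrite !expr0; exact: subst1.
by rewrite !exprS; exact: substM.
Qed.

Lemma subst_prod (I : Type) (r : seq I) (P : pred I) (f : I -> {fraction D})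
  (h : I -> L) :
  (forall i, P i -> subst (f i) (h i)) ->
  subst (\prod_(i <- r | P i) f i) (\prod_(i <- r | P i) h i).
Proof.
move=> sub; elim/big_ind2: _ => //; first exact: subst1.
by move=> *; exact: substM.
Qed.

End Substitution.

(** * Mutation of seeds *)

Lemma skew3E B i j : skew3 B -> B i j = - B j i.
Proof. by move=> /matrixP /(_ j i); rewrite !mxE. Qed.

Lemma skew3_diag B i : skew3 B -> B i i = 0.
Proof. by move=> /(skew3E _ i i); lia. Qed.

Lemma mut_mxE k B i j : mut_mx k B i j =
  if (i == k) || (j == k) then - B i j
  else B i j + Num.sg (B i k) * Num.max (B i k * B k j) 0.
Proof. by rewrite mxE. Qed.

Lemma mut_mx_col k B i : mut_mx k B i k = - B i k.
Proof. by rewrite mut_mxE eqxx orbT. Qed.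

Lemma mut_mxK k : involutive (mut_mx k).
Proof.
move=> B; apply/matrixP => i j; rewrite !mut_mxE !eqxx ?orbT /=.
case: ((i == k) || (j == k)); first by rewrite opprK.
by rewrite sgrN mulrNN mulNr addrK.
Qed.

Lemma skew3_mut k B : skew3 B -> skew3 (mut_mx k B).
Proof.
move=> sB; apply/matrixP => i j; rewrite mxE [RHS]mxE !mut_mxE orbC.
rewrite (skew3E _ j i) //; case: ((i == k) || (j == k)) => //.
rewrite (skew3E _ j k) // (skew3E _ k i) // mulrNN sgrN opprD mulrC.
rewrite [B k j * _]mulrC; congr (_ + _).
have [h|h] := leP (B i k * B k j) 0; first by rewrite !mul0r mulr0 oppr0.
rewrite mulrC mulNr; congr (- (_ * _)).
(* A positive product forces [B i k] and [B k j] to have the same sign. *)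
by move: h; case: (sgrP (B i k)); case: (sgrP (B k j)) => //; nia.
Qed.

(** * Mutation of tropical values *)

Section TropicalMutation.
Context {R : realDomainType}.

Definition trop_mut (k : 'I_3) (B : 'M[int]_3) (u : 'I_3 -> R) : 'I_3 -> R :=
  fun j => if j == k then
    Num.max (\sum_(i < 3 | (0 < B i k)%R) u i *+ `|B i k|%N)
            (\sum_(i < 3 | (B i k < 0)%R) u i *+ `|B i k|%N) - u k
  else u j.

Definition trop_mut_seed k (S : 'M[int]_3 * ('I_3 -> R)) :=
  (mut_mx k S.1, trop_mut k S.1 S.2).

Definition trop_mut_seq (s : seq 'I_3) (S : 'M[int]_3 * ('I_3 -> R)) :=
  foldl (fun T k => trop_mut_seed k T) S s.

Lemma trop_mut_seq_cat s t S :
  trop_mut_seq (s ++ t) S = trop_mut_seq t (trop_mut_seq s S).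
Proof. exact: foldl_cat. Qed.

Lemma trop_mut_seq1 s S : (trop_mut_seq s S).1 = mut_seq s S.1.
Proof. by elim: s S => //= k s IH S; rewrite IH. Qed.

Lemma trop_mut_seedK k S : skew3 S.1 -> trop_mut_seed k (trop_mut_seed k S) = S.
Proof.
case: S => B u /= sB; rewrite /trop_mut_seed /= mut_mxK; congr pair.
apply: functional_extensionality => j; rewrite /trop_mut eqxx.
case: eqP => [->|//].
have off i : 0 < B i k \/ B i k < 0 -> (i == k) = false.
  by case: eqP => // ->; rewrite skew3_diag // ltxx; case.
(* Mutation negates column [k], which swaps the two sums inside the maximum. *)
rewrite [X in Num.max X _ - (_ - _)](eq_big (fun i => B i k < 0)
    (fun i => u i *+ `|B i k|%N)); last 2 first.
- by move=> i; rewrite mut_mx_col oppr_gt0.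
- by move=> i; rewrite mut_mx_col oppr_gt0 => h; rewrite off ?abszN; last by right.
rewrite [X in Num.max _ X - (_ - _)](eq_big (fun i => 0 < B i k)
    (fun i => u i *+ `|B i k|%N)); last 2 first.
- by move=> i; rewrite mut_mx_col oppr_lt0.
- by move=> i; rewrite mut_mx_col oppr_lt0 => h; rewrite off ?abszN; last by left.
by rewrite maxC opprB addrC subrK.
Qed.

Lemma trop_mut_seqK s S : skew3 S.1 -> trop_mut_seq (rev s) (trop_mut_seq s S) = S.
Proof.
elim: s S => //= k s IH S sS.
by rewrite rev_cons -cats1 trop_mut_seq_cat IH /= ?trop_mut_seedK //; exact: skew3_mut.
Qed.

(** A nonnegative factor commutes with the maximum. This homogeneity lets an eigenvector be
    transported along further mutations. *)
Lemma trop_mut_scale (c : R) k B u : 0 <= c ->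
  trop_mut k B (fun j => c * u j) = (fun j => c * trop_mut k B u j).
Proof.
move=> c0; apply: functional_extensionality => j; rewrite /trop_mut.
case: ifP => // _; rewrite mulrBr maxr_pMr // !mulr_sumr.
by congr (Num.max _ _ - _); apply: eq_bigr => i _; rewrite mulrnAr.
Qed.

Lemma trop_mut_seq_scale (c : R) s B u : 0 <= c ->
  trop_mut_seq s (B, fun j => c * u j) =
  ((trop_mut_seq s (B, u)).1, fun j => c * (trop_mut_seq s (B, u)).2 j).
Proof.
move=> c0; elim: s B u => //= k s IH B u.
by rewrite /trop_mut_seed /= trop_mut_scale // IH.
Qed.

Lemma trop_mut_seedP (w u : 'I_3 -> R) k S :
  (forall j, trop w (sx S j) (u j)) ->
  forall j, trop w (sx (mut_seed k S) j) (trop_mut k (sB S) u j).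
Proof.
move=> tu j; rewrite /trop_mut /=; case: eqP => _; last exact: tu.
apply: tropM; last exact: tropV.
by apply: tropD; apply: trop_prod => i _; exact: tropXn.
Qed.

Lemma trop_mut_seqP (w u : 'I_3 -> R) s S :
  (forall j, trop w (sx S j) (u j)) ->
  forall j, trop w (sx (mut_seed_seq s S) j) ((trop_mut_seq s (sB S, u)).2 j).
Proof.
elim: s S u => //= k s IH S u tu.
exact: (IH (mut_seed k S) _ (trop_mut_seedP _ _ k _ tu)).
Qed.

End TropicalMutation.

Lemma mut_seed_seq_cat s t S :
  mut_seed_seq (s ++ t) S = mut_seed_seq t (mut_seed_seq s S).
Proof. exact: foldl_cat. Qed.

Lemma mut_seq_cat s t B : mut_seq (s ++ t) B = mut_seq t (mut_seq s B).
Proof. exact: foldl_cat. Qed.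

Lemma mut_seqK s B : mut_seq (rev s) (mut_seq s B) = B.
Proof.
elim: s B => //= k s IH B.
by rewrite rev_cons -cats1 mut_seq_cat IH /= mut_mxK.
Qed.

Lemma skew3_mut_seq s B : skew3 B -> skew3 (mut_seq s B).
Proof. by elim: s B => //= k s IH B /(skew3_mut k) /IH. Qed.

Lemma sB_mut_seed_seq s S : sB (mut_seed_seq s S) = mut_seq s (sB S).
Proof. by elim: s S => //= k s IH S; rewrite IH. Qed.

(** * Degrees under mutation *)

Definition gr_mut (k : 'I_3) (B : 'M[int]_3) (g : 'I_3 -> int) : 'I_3 -> int :=
  fun j => if j == k then - g k + \sum_(i < 3 | 0 < B i k) B i k * g i else g j.

Definition gr_kernel (B : 'M[int]_3) (g : 'I_3 -> int) : Prop :=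
  forall i, \sum_j B i j * g j = 0.

(** Row [k] of the kernel condition, read through skew-symmetry: both monomials of the exchange
    relation have the same degree. *)
Lemma gr_kernel_col k B g : skew3 B -> gr_kernel B g ->
  \sum_(i < 3 | 0 < B i k) B i k * g i + \sum_(i < 3 | B i k < 0) B i k * g i = 0.
Proof.
move=> sB /(_ k) gk; rewrite big_mkcond [X in _ + X]big_mkcond -big_split /=.
transitivity (- \sum_j B k j * g j); last by rewrite gk oppr0.
rewrite -sumrN; apply: eq_bigr => i _.
by rewrite (skew3E B k i) // mulNr opprK; case: (ltgtP 0 (B i k)) => [_|_|<-];
  rewrite ?addr0 ?add0r ?mul0r.
Qed.

(** Off row [k], the corrections to the entries contribute [B i k] times the positive half of column
    [k], exactly what the new degree at [k] takes away. *)
Lemma gr_kernel_mut k B g : skew3 B -> gr_kernel B g ->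
  gr_kernel (mut_mx k B) (gr_mut k B g).
Proof.
move=> sB kg i; have kk := skew3_diag B k sB; have col := gr_kernel_col k B g sB kg.
have colN : \sum_(j < 3 | B j k < 0) B j k * g j
    = - \sum_(j < 3 | 0 < B j k) B j k * g j.
  by apply/eqP; rewrite -addr_eq0 addrC; apply/eqP.
rewrite (bigD1 k) //= mut_mx_col /gr_mut eqxx.
rewrite [X in _ + X = _](eq_bigr (fun j => mut_mx k B i j * g j)); last by move=> j /negPf ->.
have [->|ik] := eqVneq i k.
  rewrite kk oppr0 mul0r add0r.
  rewrite (eq_bigr (fun j => - (B k j * g j))); last first.
    by move=> j _; rewrite mut_mxE eqxx mulNr.
  by have := kg k; rewrite (bigD1 k) //= kk mul0r add0r sumrN => ->; rewrite oppr0.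
rewrite [X in _ + X = _](eq_bigr (fun j => B i j * g j
    + Num.sg (B i k) * (Num.max (B i k * B k j) 0 * g j))); last first.
  by move=> j /negPf jk; rewrite mut_mxE (negPf ik) jk /= mulrDl mulrA.
rewrite big_split /= -mulr_sumr.
have := kg i; rewrite (bigD1 k) //= => kgi.
have -> : \sum_(j < 3 | j != k) B i j * g j = - (B i k * g k).
  by apply/eqP; rewrite -addr_eq0 addrC; apply/eqP.
have -> : \sum_(j < 3 | j != k) Num.max (B i k * B k j) 0 * g j
   = \sum_j Num.max (B i k * B k j) 0 * g j.
  by rewrite [RHS](bigD1 k) //= kk mulr0 maxxx mul0r add0r.
suff -> : Num.sg (B i k) * \sum_j Num.max (B i k * B k j) 0 * g j
    = B i k * \sum_(j < 3 | 0 < B j k) B j k * g j by ring.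
case: (sgrP (B i k)) => [->|pos|neg]; first by rewrite !mul0r.
(* For positive [B i k] the maximum selects the negative entries of column [k]; the kernel condition
   trades them for the positive ones. *)
- have -> : \sum_(j < 3 | 0 < B j k) B j k * g j
    = - \sum_(j < 3 | B j k < 0) B j k * g j by rewrite colN opprK.
  rewrite mul1r mulrN mulr_sumr -sumrN [RHS]big_mkcond /=; apply: eq_bigr => j _.
  rewrite (skew3E B k j) //; case: ltP => h.
    by rewrite max_l; [ring | nia].
  by rewrite max_r ?mul0r //; nia.
- rewrite mulN1r -sumrN mulr_sumr [RHS]big_mkcond /=; apply: eq_bigr => j _.
  rewrite (skew3E B k j) //; case: ltP => h.
    by rewrite max_l; [ring | nia].
  by rewrite max_r ?mul0r ?oppr0 //; nia.
Qed.

Lemma gr_mutK k B g : skew3 B -> gr_kernel B g ->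
  gr_mut k (mut_mx k B) (gr_mut k B g) = g.
Proof.
move=> sB kg; apply: functional_extensionality => j; rewrite /gr_mut eqxx.
case: eqP => [->|//].
have off i : B i k < 0 -> (i == k) = false.
  by case: eqP => // ->; rewrite skew3_diag // ltxx.
rewrite [X in _ + X = _](eq_big (fun i => B i k < 0)
    (fun i => - (B i k * g i))); last 2 first.
- by move=> i; rewrite mut_mx_col oppr_gt0.
- by move=> i; rewrite mut_mx_col oppr_gt0 => h; rewrite off ?mulNr.
have /eqP := gr_kernel_col k B g sB kg; rewrite addrC addr_eq0 sumrN => /eqP ->.
by ring.
Qed.

(* Stated over an abstract field: unification at the concrete fraction field
   unfolds its quotient construction. *)
Definition cl_mut {L : fieldType} (k : 'I_3) (B : 'M[int]_3) (x : 'I_3 -> L) :=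
  fun j => if j == k then
      ((\prod_(i < 3 | 0 < B i k) x i ^+ `|B i k|%N)
       + (\prod_(i < 3 | B i k < 0) x i ^+ `|B i k|%N)) / x k
    else x j.

Lemma cl_mutK {L : fieldType} k B (x : 'I_3 -> L) : skew3 B ->
  x k != 0 -> cl_mut k B x k != 0 -> cl_mut k (mut_mx k B) (cl_mut k B x) = x.
Proof.
rewrite {1}/cl_mut eqxx => sB xk xk'; apply: functional_extensionality => j.
rewrite /cl_mut eqxx; case: eqP => [->|//].
have off i : 0 < B i k \/ B i k < 0 -> (i == k) = false.
  by case: eqP => // ->; rewrite skew3_diag // ltxx; case.
rewrite [X in (X + _) / _](eq_big (fun i => B i k < 0)
    (fun i => x i ^+ `|B i k|%N)); last 2 first.
- by move=> i; rewrite mut_mx_col oppr_gt0.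
- by move=> i; rewrite mut_mx_col oppr_gt0 => h; rewrite off ?abszN; last by right.
rewrite [X in (_ + X) / _](eq_big (fun i => 0 < B i k)
    (fun i => x i ^+ `|B i k|%N)); last 2 first.
- by move=> i; rewrite mut_mx_col oppr_lt0.
- by move=> i; rewrite mut_mx_col oppr_lt0 => h; rewrite off ?abszN; last by left.
rewrite addrC invf_div mulrCA mulfV ?mulr1 //.
by apply: contraNneq xk' => ->; rewrite mul0r.
Qed.

Lemma mut_seedE k S : mut_seed k S =
  GSeed (cl_mut k (sB S) (sx S)) (mut_mx k (sB S)) (gr_mut k (sB S) (sg S)).
Proof. by []. Qed.

Lemma mut_seedK k S : skew3 (sB S) -> gr_kernel (sB S) (sg S) ->
  sx S k != 0 -> sx (mut_seed k S) k != 0 -> mut_seed k (mut_seed k S) = S.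
Proof.
case: S => x B g sB kg xk xk'; rewrite !mut_seedE mut_mxK gr_mutK //.
by rewrite (cl_mutK k B x sB xk xk').
Qed.

(** The tropical value at weight zero certifies that every cluster variable is nonzero, as inverting
    a mutation and substituting require. *)
Definition regular_seed (S : gseed) : Prop :=
  [/\ skew3 (sB S), gr_kernel (sB S) (sg S)
    & exists u : 'I_3 -> int, forall j, trop (fun=> 0) (sx S j) (u j)].

Lemma regular_seed_neq0 S j : regular_seed S -> sx S j != 0.
Proof. by case=> _ _ [u /(_ j)]; exact: trop_neq0. Qed.

Lemma regular_seed_mut k S : regular_seed S -> regular_seed (mut_seed k S).
Proof.
case=> sS kS [u tu]; split; [exact: skew3_mut | exact: gr_kernel_mut |].
by exists (trop_mut k (sB S) u); exact: trop_mut_seedP.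
Qed.

Lemma regular_seed_mut_seq s S : regular_seed S -> regular_seed (mut_seed_seq s S).
Proof. by elim: s S => //= k s IH S rS; apply: IH; exact: regular_seed_mut. Qed.

Lemma mut_seed_seqK s S : regular_seed S -> mut_seed_seq (rev s) (mut_seed_seq s S) = S.
Proof.
elim: s S => //= k s IH S rS; have rS' := regular_seed_mut k S rS.
rewrite rev_cons -cats1 mut_seed_seq_cat IH //=.
by apply: mut_seedK; rewrite ?regular_seed_neq0 //; case: rS.
Qed.

Lemma regular_init_seed A (g : 'cV[int]_3) :
  skew3 A -> A *m g = 0 -> regular_seed (init_seed A g).
Proof.
move=> sA Ag; split=> //= [i|]; first by move/matrixP/(_ i ord0): Ag; rewrite !mxE.
by exists (fun=> 0) => j; exact: tropX.
Qed.

(** Seeds with equal matrices mutate by the same formula; regularity keeps the divisions legitimate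
    on both sides. *)
Lemma subst_mut_seed_seq (ev : {rmorphism {mpoly int[3]} -> F}) s S T :
  regular_seed S -> regular_seed T -> sB S = sB T ->
  (forall j, subst ev (sx S j) (sx T j)) ->
  forall j, subst ev (sx (mut_seed_seq s S) j) (sx (mut_seed_seq s T) j).
Proof.
elim: s S T => //= k s IH S T rS rT eB sub; apply: IH; rewrite /= ?eB //;
  try exact: regular_seed_mut.
move=> j; case: eqP => // _.
apply: substM; last by apply: substV; rewrite ?regular_seed_neq0.
by apply: substD; apply: subst_prod => i _; exact: substXn.
Qed.

(** * Positivity along the acyclic belt *)

Lemma ord3_cases (i j k l : 'I_3) : uniq [:: i; j; k] -> [\/ l = i, l = j | l = k].
Proof.
move=> u; have [|lN] := boolP (l \in [:: i; j; k]).
  by rewrite !inE => /or3P [] /eqP; [constructor 1 | constructor 2 | constructor 3].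
(* A fourth distinct index would exceed the cardinality of ['I_3]. *)
have /card_uniqP c : uniq [:: l; i; j; k] by rewrite cons_uniq lN.
by have := max_card (mem [:: l; i; j; k]); rewrite c card_ord.
Qed.

(** * Estimates for the Coxeter eigenvector *)

Section Eigenvector.
Context {R : realFieldType}.

(* The eigenvector equation of the threefold source mutation (the Coxeter
   transformation) of the quiver 1 -a-> 2 -b-> 3, 1 -c-> 3: one source mutation
   replaces (w1, w2, w3) by (w2, w3, L w1) and (a, b, c) by (b, c, a). *)
Definition eigen (L a b c w1 w2 w3 : R) : Prop :=
  [/\ (1 + L) * w1 = a * w2 + c * w3,
      (1 + L) * w2 = b * w3 + a * L * w1,
      (1 + L) * w3 = c * L * w1 + b * L * w2
    & [/\ 0 < w1, 0 < w2 & 0 < w3]].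

(** The bound [5 / 2] is what a constant of at least 5 gives for the larger root. Integrality of the
    multiplicities survives over the reals as the gap between 0 and 1; [a] and [b] are nonzero so
    that the middle vertex is neither a source nor a sink. *)
Definition wild (L a b c : R) : Prop :=
  [/\ 5 / 2 <= L, 1 <= a, 1 <= b, c = 0 \/ 1 <= c
    & (1 + L) ^+ 2 = (a ^+ 2 + b ^+ 2 + c ^+ 2 + a * b * c) * L].

Implicit Types L a b c w : R.

Lemma eigen_source L a b c w1 w2 w3 : 5 / 2 <= L ->
  eigen L a b c w1 w2 w3 -> eigen L b c a w2 w3 (L * w1).
Proof.
move=> L_ge [e1 e2 e3 [p1 p2 p3]]; split; [lra | lra | | split=> //; nra].
by rewrite mulrCA e1; lra.
Qed.

Lemma eigen_sink L a b c w1 w2 w3 : 5 / 2 <= L ->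
  eigen L a b c w1 w2 w3 -> eigen L c a b (L^-1 * w3) w1 w2.
Proof.
move=> L_ge [e1 e2 e3 [p1 p2 p3]]; have L_gt0 : 0 < L by lra.
have LV : L * L^-1 = 1 by rewrite mulfV ?gt_eqF.
have LVp : 0 < L^-1 by rewrite invr_gt0.
have shift x : L * (L^-1 * x) = x by rewrite mulrA LV mul1r.
split.
- by apply: (mulfI (lt0r_neq0 L_gt0)); rewrite mulrCA shift; lra.
- by rewrite -mulrA shift; lra.
- by rewrite -mulrA shift; lra.
- by split=> //; rewrite mulr_gt0.
Qed.

(** With [a = 0] the vertices 1 and 2 are both sources, and either may come first. *)
Lemma eigen_swap12 L b c w1 w2 w3 :
  eigen L 0 b c w1 w2 w3 -> eigen L 0 c b w2 w1 w3.
Proof. by case=> e1 e2 e3 [p1 p2 p3]; split; [lra | lra | lra | split]. Qed.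

Lemma eigen_swap23 L a c w1 w2 w3 :
  eigen L a 0 c w1 w2 w3 -> eigen L c 0 a w1 w3 w2.
Proof. by case=> e1 e2 e3 [p1 p2 p3]; split; [lra | lra | lra | split]. Qed.

(** Eliminating [w2] from the first two equations and rewriting [(1 + L) ^+ 2] fixes the ratio of
    [w1] to [w3]. *)
Lemma eigen_ratio L a b c w1 w2 w3 : wild L a b c -> eigen L a b c w1 w2 w3 ->
  L * (b ^+ 2 + c ^+ 2 + a * b * c) * w1 = (a * b + c + c * L) * w3.
Proof.
move=> [_ _ _ _ L_eq] [e1 e2 e3 _].
have h1 : (1 + L) * ((1 + L) * w1) = (1 + L) * (a * w2 + c * w3) by rewrite e1.
have h2 : a * ((1 + L) * w2) = a * (b * w3 + a * L * w1) by rewrite e2.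
have h3 : (1 + L) ^+ 2 * w1 = (a ^+ 2 + b ^+ 2 + c ^+ 2 + a * b * c) * L * w1.
  by rewrite L_eq.
by lra.
Qed.

Lemma wild_ratio_gt1 L a b c : wild L a b c ->
  a * b + c + c * L < L * (b ^+ 2 + c ^+ 2 + a * b * c).
Proof.
move=> [L_ge a_ge b_ge c_ge L_eq]; have bb : 1 <= b ^+ 2 by nra.
case: c_ge => [c0|c1].
  have Lba : a < L * b.
    rewrite ltNge; apply/negP => le.
    have La : L <= a by nra.
    (* From [L >= 5/2], [(1 + 1/L)^2 <= 49/25], which is below [2 - 1/50]; but [a >= L] makes the
       right-hand side of [L_eq] at least [L^3]. *)
    have : (1 + L) ^+ 2 <= 2 * L ^+ 2 - L ^+ 2 / 50 by nra.
    by move: L_eq; rewrite c0; nra.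
  by rewrite c0; nra.
have cc : c <= c ^+ 2 by nra.
have h1 : c * L <= c ^+ 2 * L by nra.
have ab1 : 1 <= a * b by nra.
have h2 : c <= a * b * c by nra.
have h3 : a * b <= a * b * c by nra.
have h4 : 5 / 2 * (a * b * c) <= L * (a * b * c) by nra.
have h5 : 0 < L * b ^+ 2 by nra.
by nra.
Qed.

Lemma eigen13 L a b c w1 w2 w3 :
  wild L a b c -> eigen L a b c w1 w2 w3 ->
  w1 < w3.
Proof.
move=> W E; case: (W) (E) => L_ge a_ge b_ge c_ge _ [_ _ _ [p1 p2 p3]].
rewrite ltNge; apply/negP => le31.
have c0 : 0 <= c by case: c_ge => [->|]; lra.
have : 0 <= a * b + c + c * L by nra.
have := eigen_ratio _ _ _ _ _ _ _ W E; have := wild_ratio_gt1 _ _ _ _ W.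
set X := a * b + c + c * L; set Y := L * _ => XY e X0.
have : X * w3 <= X * w1 by nra.
have : X * w1 < Y * w1 by nra.
by lra.
Qed.

(** The third equation gives [2 L w2 <= (1 + L) w3 <= 2 L w3], hence [w2 <= w3]. *)
Lemma eigen23 L a b c w1 w2 w3 :
  wild L a b c -> eigen L a b c w1 w2 w3 ->
  2 <= b -> w2 <= (b - 1) * w3.
Proof.
move=> W E; have p := eigen13 _ _ _ _ _ _ _ W E.
case: (W) (E) => L_ge a_ge b_ge c_ge L_eq [e1 e2 e3 [p1 p2 p3]] b2.
have L0 : 0 < L by lra.
have c0 : 0 <= c by case: c_ge => [->|]; lra.
have h0 : 0 <= c * (L * w1) by rewrite !mulr_ge0 // ltW.
have h1 : L * (2 * w2) <= L * (b * w2) by rewrite (ler_pM2l L0) ler_pM2r.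
have h2 : L * (2 * w2) <= (1 + L) * w3 by lra.
have h3 : (1 + L) * w3 <= L * (2 * w3) by nra.
have h4 : w2 <= w3 by have := le_trans h2 h3; rewrite (ler_pM2l L0); lra.
by nra.
Qed.

(** The first equation gives [w2 + w3 <= (1 + L) w1], so [w1 < w3] yields [w2 < L w1]; then the
    third puts [(1 + L) w3] above [(1 + L) w2]. *)
Lemma eigen23_1 L a b c w1 w2 w3 :
  wild L a b c -> eigen L a b c w1 w2 w3 ->
  b = 1 -> 1 <= c -> w2 < w3.
Proof.
move=> W E; have p := eigen13 _ _ _ _ _ _ _ W E.
case: (W) (E) => L_ge a_ge b_ge c_ge L_eq [e1 e2 e3 [p1 p2 p3]] b1 c1.
rewrite b1 in e3.
have h1 : w2 <= a * w2 by nra.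
have h2 : w3 <= c * w3 by nra.
have h3 : L * w1 <= c * (L * w1) by nra.
have h4 : 0 < (1 + L) * (w3 - w2) by lra.
have L1 : 0 < 1 + L by lra.
by move: h4; rewrite (pmulr_rgt0 _ L1) subr_gt0.
Qed.

(** The second equation reads [L (a w1 - w2) = w2 - w3], and the third, [L w2 = (1 + L) w3], makes
    this positive. *)
Lemma eigen12_0 L a b c w1 w2 w3 :
  wild L a b c -> eigen L a b c w1 w2 w3 ->
  b = 1 -> c = 0 -> w2 < a * w1.
Proof.
move=> W E; have p := eigen13 _ _ _ _ _ _ _ W E.
case: (W) (E) => L_ge a_ge b_ge c_ge L_eq [e1 e2 e3 [p1 p2 p3]] b1 c0.
have L0 : 0 < L by lra.
rewrite b1 c0 in e2 e3.
have h4 : 0 < L * (a * w1 - w2) by nra.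
by move: h4; rewrite (pmulr_rgt0 _ L0) subr_gt0.
Qed.

Lemma eigen12_0' L a b c w1 w2 w3 :
  wild L a b c -> eigen L a b c w1 w2 w3 ->
  b = 1 -> c = 0 -> w1 < w2.
Proof.
move=> W E; have p := eigen13 _ _ _ _ _ _ _ W E.
case: (W) (E) => L_ge a_ge b_ge c_ge L_eq [e1 e2 e3 [p1 p2 p3]] b1 c0.
have L0 : 0 < L by lra.
rewrite b1 c0 in e2 e3.
have h4 : 0 < L * (w2 - w1) by nra.
by move: h4; rewrite (pmulr_rgt0 _ L0) subr_gt0.
Qed.

(** Which term exceeds [w2] depends on the quiver: [b w3] if [b >= 2] or [c >= 1], and [a w1] if
    [b = 1] and [c = 0]. The value produced by mutation at the middle vertex is therefore
    positive. *)
Lemma eigen_mid_gt0 L a b c w1 w2 w3 :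
  wild L a b c -> eigen L a b c w1 w2 w3 ->
  b = 1 \/ 2 <= b -> w2 < Num.max (a * w1) (b * w3).
Proof.
move=> W E; have p := eigen13 _ _ _ _ _ _ _ W E.
case: (W) (E) => L_ge a_ge b_ge c_ge L_eq [e1 e2 e3 [p1 p2 p3]].
move=> b_int; rewrite lt_max; case: b_int => [b1|b2]; last first.
  by have := (eigen23 _ _ _ _ _ _ _ W E) b2 => h; apply/orP; right; lra.
case: c_ge => [c0|c1]; first by rewrite (eigen12_0 _ _ _ _ _ _ _ W E).
by rewrite b1 mul1r (eigen23_1 _ _ _ _ _ _ _ W E) ?orbT.
Qed.

(** Here [e] and [X] are the values produced by mutating at vertex 2 and then at vertex 1. The
    newest value dominates, which starts the growth away from the belt. *)
Lemma eigen_far1 L a b c w1 w2 w3 :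
  wild L a b c -> eigen L a b c w1 w2 w3 ->
  b = 1 \/ 2 <= b -> 2 <= a ->
  let e := Num.max (a * w1) (b * w3) - w2 in
  let X := Num.max (a * e) ((c + a * b) * w3) - w1 in w3 <= X /\ e <= X.
Proof.
move=> W E; have p := eigen13 _ _ _ _ _ _ _ W E.
case: (W) (E) => L_ge a_ge b_ge c_ge L_eq [e1 e2 e3 [p1 p2 p3]].
move=> b_int a2 e X.
have c0 : 0 <= c by case: c_ge => [->|]; lra.
have XX : (c + a * b) * w3 - w1 <= X by rewrite lerD2r le_max lexx orbT.
have ab : a <= a * b by nra.
split; apply: le_trans XX; first by nra.
have h1 : b * w3 - w2 <= (c + a * b) * w3 - w1.
  have : b + 1 <= c + a * b by nra.
  by nra.
have h2 : a * w1 - w2 <= (c + a * b) * w3 - w1.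
  have cw : 0 <= c * w3 by nra.
  case: b_int => [b1|b2]; last first.
    have : a + 1 <= a * b by nra.
    by nra.
  case: c_ge => [c00|c1].
    by have := (eigen12_0' _ _ _ _ _ _ _ W E) b1 c00; rewrite b1 c00; nra.
  by rewrite b1; nra.
by rewrite /e; case: (leP (a * w1)) => _; [exact: h1 | exact: h2].
Qed.

(** The counterpart for vertex 2 followed by vertex 3: since [w3 <= e], already [b e - w3]
    dominates. *)
Lemma eigen_far3 L a b c w1 w2 w3 :
  wild L a b c -> eigen L a b c w1 w2 w3 ->
  2 <= b ->
  let e := Num.max (a * w1) (b * w3) - w2 in
  let Y := Num.max ((c + a * b) * w1) (b * e) - w3 in w1 <= Y /\ e <= Y.
Proof.
move=> W E; have p := eigen13 _ _ _ _ _ _ _ W E.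
case: (W) (E) => L_ge a_ge b_ge c_ge L_eq [e1 e2 e3 [p1 p2 p3]].
move=> b2 e Y; have h := eigen23 _ _ _ _ _ _ _ W E b2.
have YY : b * e - w3 <= Y by rewrite lerD2r le_max lexx orbT.
have e_ge : w3 <= e.
  have : b * w3 - w2 <= e by rewrite lerD2r le_max lexx orbT.
  by lra.
have eY : e <= b * e - w3 by nra.
by split; apply: le_trans YY => //; lra.
Qed.

(* The next six identities are the tropical shadow of the pentagon relation:
   next to a single arrow, mutating twice off the belt leads back to it. *)
Lemma pentagon_source L b c w1 w2 w3 : 0 < L -> 0 <= c -> eigen L 1 b c w1 w2 w3 ->
  Num.max (Num.max w1 (b * w3) - w2) ((c + b) * w3) - w1 = L * w2.
Proof.
move=> L0 c0 [e1 e2 e3 [p1 p2 p3]].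
have cw : 0 <= c * w3 by rewrite mulr_ge0 // ltW.
have Lw : 0 < L * w2 by rewrite mulr_gt0.
rewrite max_r; first by lra.
by case: (leP w1) => _; lra.
Qed.

Lemma pentagon_source_mid L b c w1 w2 w3 : eigen L 1 b c w1 w2 w3 ->
  Num.max (c * w3) (L * w2) - L * w1 = Num.max w1 (b * w3) - w2.
Proof.
by move=> [e1 e2 e3 [p1 p2 p3]]; case: (leP (c * w3)); case: (leP w1) => *; lra.
Qed.

Lemma pentagon_source_end L b w1 w2 w3 : 0 < L -> eigen L 1 b 0 w1 w2 w3 ->
  Num.max w1 (b * w3) - w2 = L * (L * w1).
Proof.
move=> L0 [e1 e2 e3 [p1 p2 p3]].
have Lw : 0 < L * w1 by rewrite mulr_gt0.
have LLw : 0 < L * (L * w1) by rewrite mulr_gt0.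
by rewrite max_r; nra.
Qed.

Lemma pentagon_sink L a c w1 w2 w3 : 0 < L -> 0 <= c -> eigen L a 1 c w1 w2 w3 ->
  Num.max ((c + a) * w1) (Num.max (a * w1) w3 - w2) - w3 = L^-1 * w2.
Proof.
move=> L0 c0 [e1 e2 e3 [p1 p2 p3]]; have LN0 : L != 0 by rewrite gt_eqF.
have cw : 0 <= c * w1 by rewrite mulr_ge0 // ltW.
have Lw : 0 < L^-1 * w2 by rewrite mulr_gt0 ?invr_gt0.
have eq : (c + a) * w1 - w3 = L^-1 * w2.
  by apply: (mulfI LN0); rewrite [RHS]mulrA mulfV // mul1r; lra.
rewrite max_l //; case: (leP (a * w1)) => _; lra.
Qed.

Lemma pentagon_sink_mid L a c w1 w2 w3 : 0 < L -> eigen L a 1 c w1 w2 w3 ->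
  Num.max (L^-1 * w2) (c * w1) - L^-1 * w3 = Num.max (a * w1) w3 - w2.
Proof.
move=> L0 [e1 e2 e3 [p1 p2 p3]]; have LN0 : L != 0 by rewrite gt_eqF.
have eq1 : L^-1 * w2 - L^-1 * w3 = a * w1 - w2.
  apply: (mulfI LN0); rewrite mulrBr !mulrA mulfV // !mul1r; lra.
have eq2 : c * w1 - L^-1 * w3 = w3 - w2.
  apply: (mulfI LN0); rewrite mulrBr [L * (L^-1 * _)]mulrA mulfV // mul1r; lra.
by case: (leP (L^-1 * w2)); case: (leP (a * w1)) => *; lra.
Qed.

Lemma pentagon_sink_end L a w1 w2 w3 : 0 < L -> eigen L a 1 0 w1 w2 w3 ->
  Num.max (a * w1) w3 - w2 = L^-1 * (L^-1 * w3).
Proof.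
move=> L0 [e1 e2 e3 [p1 p2 p3]]; have LN0 : L != 0 by rewrite gt_eqF.
have p : 0 < L^-1 * w3 by rewrite mulr_gt0 ?invr_gt0.
have pp : 0 < L^-1 * (L^-1 * w3) by rewrite mulr_gt0 ?invr_gt0.
have eq1 : w2 - w3 = L^-1 * w3.
  by apply: (mulfI LN0); rewrite [RHS]mulrA mulfV // mul1r; lra.
have eq2 : a * w1 - w2 = L^-1 * (L^-1 * w3).
  by apply: (mulfI LN0); rewrite [RHS]mulrA mulfV // mul1r -eq1; lra.
by rewrite max_l; lra.
Qed.

End Eigenvector.

(** Positive pairwise sums say that at most one multiplicity vanishes, so the quiver is connected;
    [C] is its Markov constant. *)
Definition acyclic_params (C a b c : int) : Prop :=
  [/\ [/\ 0 <= a, 0 <= b & 0 <= c], [/\ 0 < a + b, 0 < b + c & 0 < a + c]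
    & a ^+ 2 + b ^+ 2 + c ^+ 2 + a * b * c = C].

Lemma acyclic_params_rot C a b c : acyclic_params C a b c -> acyclic_params C b c a.
Proof. by case=> [[? ? ?] [? ? ?] ?]; split; split || idtac; lia. Qed.

Lemma acyclic_params_swap C a b c : acyclic_params C a b c -> acyclic_params C c b a.
Proof. by case=> [[? ? ?] [? ? ?] ?]; split; split || idtac; lia. Qed.

(** Two mutations off the belt the newest multiplicity is the largest: [b >= 2] at least doubles
    [m], while [a <= m]. *)
Lemma far_entries (a b c : int) : 0 < a -> 2 <= b -> 0 <= c ->
  let m := c + a * b in [/\ 2 <= m, 2 <= b, m <= m * b - a & b <= m * b - a].
Proof.
move=> a0 b2 c0 m; have [am bm] : a <= m /\ b <= m by split; rewrite /m; nia.
clearbody m; have : 2 * m <= m * b by nia.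
by split; lia.
Qed.

Lemma far_entries_step (x y z : int) : 2 <= x -> 2 <= z -> x <= y -> z <= y ->
  [/\ 2 <= x, 2 <= y, x <= x * y - z & y <= x * y - z].
Proof.
move=> x2 z2 xy zy; have : 2 * y <= x * y by nia.
by split; lia.
Qed.

(** * Seeds reachable from the belt *)

Section Positivity.
Context {R : realFieldType}.
Local Notation seed := ('M[int]_3 * ('I_3 -> R))%type.

(** Entries are read around the cycle, so rotating the indices brings any vertex to the middle place
    and reversing them changes all signs. *)
Definition coords (i j k : 'I_3) (p q r : int) (x y z : R) (S : seed) : Prop :=
  [/\ uniq [:: i; j; k], skew3 S.1, [/\ S.1 i j = p, S.1 j k = q & S.1 k i = r]
    & [/\ S.2 i = x, S.2 j = y & S.2 k = z]].

Lemma coords_rot i j k p q r x y z S :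
  coords i j k p q r x y z S -> coords j k i q r p y z x S.
Proof. by case=> u s [? ? ?] [? ? ?]; split=> //; rewrite -(rot_uniq 1) in u. Qed.

Lemma coords_rev i j k p q r x y z S :
  coords i j k p q r x y z S -> coords k j i (- q) (- p) (- r) z y x S.
Proof.
case=> u s [<- <- <-] [? ? ?]; split=> //; first by rewrite -rev_uniq in u.
by rewrite -!(skew3E _ _ _ s).
Qed.

Lemma coords_mut i j k p q r x y z S : coords i j k p q r x y z S ->
  coords i j k (- p) (- q) (r - Num.sg p * Num.max (p * q) 0) x
    (Num.max ((Num.max p 0)%:~R * x + (Num.max (- q) 0)%:~R * z)
             ((Num.max (- p) 0)%:~R * x + (Num.max q 0)%:~R * z) - y) z
    (trop_mut_seed j S).
Proof.
case: S => B v [u s /= [pE qE rE] [xE yE zE]].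
have [ij ik jk] : [/\ i != j, i != k & j != k].
  by move: u; rewrite /= !inE negb_or => /andP [/andP [-> ->] /andP [->]].
have kE : B k j = - q by rewrite (skew3E _ _ _ s) qE.
have sumE (P : pred 'I_3) (f : 'I_3 -> R) : ~~ P j ->
    \sum_(l < 3 | P l) f l = (if P i then f i else 0) + (if P k then f k else 0).
  move=> /negPf Pj; rewrite (perm_big [:: i; j; k]) /=; last first.
    apply: uniq_perm => [||l]; rewrite ?index_enum_uniq // mem_index_enum !inE.
    by case: (ord3_cases i j k l u) => ->; rewrite eqxx ?orbT.
  by rewrite !big_cons big_nil Pj; do 2 case: ifP => _; rewrite ?addr0 ?add0r.
have pos (m : int) (t : R) :
    (if 0 < m then t *+ `|m| else 0) = (Num.max m 0)%:~R * t.
  case: ltrP => [m0|m0]; last by rewrite mul0r.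
  by rewrite pmulrn gez0_abs ?ltW // mulrzl.
have neg (m : int) (t : R) :
    (if m < 0 then t *+ `|m| else 0) = (Num.max (- m) 0)%:~R * t.
  by rewrite -pos oppr_gt0 abszN.
split=> //=; first exact: skew3_mut.
  rewrite !mut_mxE !eqxx orbT (negPf ij) !(eq_sym k) (negPf jk) orbF /= pE qE rE.
  split=> //; rewrite (skew3E B j i) // kE pE sgrN mulrNN mulNr mulrC [q * p]mulrC.
  congr (_ - _); have [h|h] := leP (p * q) 0; first by rewrite mul0r mulr0.
  rewrite mulrC; congr (_ * _).
  by move: h; case: (sgrP p); case: (sgrP q) => //; nia.
rewrite /trop_mut eqxx (negPf ij) eq_sym (negPf jk); split=> //.
rewrite !sumE ?(skew3_diag _ _ s) ?ltxx // !pos !neg pE kE yE xE zE opprK.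
by [].
Qed.

Lemma coords_pass i j k p q r x y z S : 0 <= p -> 0 <= q ->
  coords i j k p q r x y z S ->
  coords i j k (- p) (- q) (r - p * q) x
    (Num.max (p%:~R * x) (q%:~R * z) - y) z (trop_mut_seed j S).
Proof.
move=> p0 q0 /coords_mut.
have [Np0 Nq0] : - p <= 0 /\ - q <= 0 by lia.
rewrite (max_l p0) (max_l q0) (max_r Np0) (max_r Nq0) !mulr0z !mul0r addr0 add0r.
rewrite (max_l (mulr_ge0 p0 q0)); have [->|pN0] := eqVneq p 0; first by rewrite sgr0 !mul0r.
by rewrite gtr0_sg ?mul1r // lt_def pN0.
Qed.

Lemma coords_source i j k p q r x y z S : 0 <= p -> 0 <= q ->
  coords i j k (- p) q r x y z S ->
  coords i j k p (- q) r x
    (Num.max 0 (p%:~R * x + q%:~R * z) - y) z (trop_mut_seed j S).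
Proof.
move=> p0 q0 /coords_mut; rewrite opprK (max_l p0) (max_l q0) mulNr.
have [Np0 Nq0 Npq] : [/\ - p <= 0, - q <= 0 & - (p * q) <= 0].
  by rewrite !oppr_le0 mulr_ge0.
by rewrite (max_r Np0) (max_r Nq0) (max_r Npq) !mulr0z !mul0r addr0 mulr0 subr0.
Qed.

Lemma coords_sink i j k p q r x y z S : 0 <= p -> 0 <= q ->
  coords i j k p (- q) r x y z S ->
  coords i j k (- p) q r x
    (Num.max (p%:~R * x + q%:~R * z) 0 - y) z (trop_mut_seed j S).
Proof.
move=> p0 q0 /coords_mut; rewrite opprK (max_l p0) (max_l q0) mulrN.
have [Np0 Nq0 Npq] : [/\ - p <= 0, - q <= 0 & - (p * q) <= 0].
  by rewrite !oppr_le0 mulr_ge0.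
by rewrite (max_r Np0) (max_r Nq0) (max_r Npq) !mulr0z !mul0r addr0 mulr0 subr0.
Qed.

Variables (C : int) (L : R).

Local Notation eig a b c := (eigen L a%:~R b%:~R c%:~R).

Definition acyclic_state (S : seed) : Prop :=
  exists i j k a b c w1 w2 w3, [/\ acyclic_params C a b c, eig a b c w1 w2 w3
    & coords i j k a b (- c) w1 w2 w3 S].

(** Mutating an acyclic seed at its middle vertex gives an oriented cycle, listed in reversed order
    to keep its entries positive. *)
Definition middle_state (S : seed) : Prop :=
  exists i j k a b c w1 w2 w3,
    [/\ acyclic_params C a b c, 0 < a /\ 0 < b, eig a b c w1 w2 w3
    & coords k j i b a (c + a * b) w3
        (Num.max (a%:~R * w1) (b%:~R * w3) - w2) w1 S].

(** The vertex [r] is the one mutated last: it carries the largest value, and the arrows opposite to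
    it are the most numerous. *)
Definition far_state (r : 'I_3) (S : seed) : Prop :=
  exists s t x y z X Y Z, [/\ [/\ 2 <= x, 2 <= z, x <= y & z <= y],
    [/\ 0 < Y, 0 < Z, Y <= X & Z <= X] & coords r s t x y z X Y Z S].

(* A far seed remembers the seed it was mutated from, so that the set is
   closed under the backward mutation too. *)
Inductive belt_tree : seed -> Prop :=
| BeltAcyclic S : acyclic_state S -> belt_tree S
| BeltMiddle S : middle_state S -> belt_tree S
| BeltFar r S : belt_tree S -> far_state r (trop_mut_seed r S) ->
    belt_tree (trop_mut_seed r S).

Hypothesis L_ge : 5 / 2 <= L.
Hypothesis L_eq : (1 + L) ^+ 2 = C%:~R * L.

Let L_gt0 : 0 < L. Proof. by apply: lt_le_trans L_ge; lra. Qed.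
Let L_neq0 : L != 0. Proof. by rewrite gt_eqF. Qed.

Lemma acyclic_params_wild a b c : acyclic_params C a b c -> 0 < a -> 0 < b ->
  wild L a%:~R b%:~R c%:~R.
Proof.
move=> [[_ _ c0] _ CE] a0 b0; split=> //.
- by rewrite -[1]/(1%:~R) ler_int.
- by rewrite -[1]/(1%:~R) ler_int.
- have [->|cN0] := eqVneq c 0; [by left | right].
  by rewrite -[1]/(1%:~R) ler_int; lia.
- by rewrite L_eq -CE !(intrD, rmorphXn, intrM).
Qed.

Lemma acyclic_stateI i j k a b c w1 w2 w3 S :
  acyclic_params C a b c -> eig a b c w1 w2 w3 ->
  coords i j k a b (- c) w1 w2 w3 S -> acyclic_state S.
Proof. by move=> *; exists i, j, k, a, b, c, w1, w2, w3. Qed.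

Lemma acyclic_source i j k a b c w1 w2 w3 S :
  acyclic_params C a b c -> eig a b c w1 w2 w3 ->
  coords i j k a b (- c) w1 w2 w3 S ->
  coords j k i b c (- a) w2 w3 (L * w1) (trop_mut_seed i S).
Proof.
move=> [[a0 b0 c0] _ _] [e1 _ _ [p1 p2 p3]].
move=> /coords_rot /coords_rot /(coords_source _ _ _ _ _ _ _ _ _ _ c0 a0).
have -> : Num.max 0 (c%:~R * w3 + a%:~R * w2) - w1 = L * w1.
  rewrite max_r; first by lra.
  by rewrite addr_ge0 // mulr_ge0 ?ler0z // ltW.
by move=> /coords_rot /coords_rot.
Qed.

Lemma acyclic_sink i j k a b c w1 w2 w3 S :
  acyclic_params C a b c -> eig a b c w1 w2 w3 ->
  coords i j k a b (- c) w1 w2 w3 S ->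
  coords k i j c a (- b) (L^-1 * w3) w1 w2 (trop_mut_seed k S).
Proof.
move=> [[a0 b0 c0] _ _] [_ _ e3 [p1 p2 p3]].
move=> /coords_rot /(coords_sink _ _ _ _ _ _ _ _ _ _ b0 c0).
have -> : Num.max (b%:~R * w2 + c%:~R * w1) 0 - w3 = L^-1 * w3.
  rewrite max_l; last by rewrite addr_ge0 // mulr_ge0 ?ler0z // ltW.
  by apply: (mulfI L_neq0); rewrite mulrA mulfV // mul1r; lra.
by move=> /coords_rot.
Qed.

Lemma acyclic_state_source i j k a b c w1 w2 w3 S :
  acyclic_params C a b c -> eig a b c w1 w2 w3 ->
  coords i j k a b (- c) w1 w2 w3 S -> acyclic_state (trop_mut_seed i S).
Proof.
move=> P E cS; apply: (acyclic_stateI _ _ _ _ _ _ _ _ _ _ _ _ (acyclic_source _ _ _ _ _ _ _ _ _ _ P E cS)).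
  exact: acyclic_params_rot.
exact: eigen_source.
Qed.

Lemma acyclic_state_sink i j k a b c w1 w2 w3 S :
  acyclic_params C a b c -> eig a b c w1 w2 w3 ->
  coords i j k a b (- c) w1 w2 w3 S -> acyclic_state (trop_mut_seed k S).
Proof.
move=> P E cS; apply: (acyclic_stateI _ _ _ _ _ _ _ _ _ _ _ _ (acyclic_sink _ _ _ _ _ _ _ _ _ _ P E cS)).
  by do 2 apply: acyclic_params_rot.
exact: eigen_sink.
Qed.

Lemma acyclic_state_mut l S : acyclic_state S -> belt_tree (trop_mut_seed l S).
Proof.
move=> [i [j [k [a [b [c [w1 [w2 [w3 [P E cS]]]]]]]]]].
have u : uniq [:: i; j; k] by case: cS.
have [[a0 b0 c0] ab CE] := P; have [e1 e2 e3 [p1 p2 p3]] := E.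
case: (ord3_cases i j k l u) => ->.
- by apply: BeltAcyclic; exact: acyclic_state_source cS.
(* Without arrows between [i] and [j], the vertex [j] is a source as well. *)
- have [aE|aN0] := eqVneq a 0.
    apply: BeltAcyclic; apply: (acyclic_state_source j i k 0 c b w2 w1 w3).
    + by rewrite aE in P; exact/acyclic_params_rot/acyclic_params_rot/acyclic_params_swap.
    + by move: E; rewrite aE mulr0z => /eigen_swap12.
    + by move: cS => /coords_rev /coords_rot; rewrite aE oppr0 opprK.
  (* Without arrows between [j] and [k], the vertex [j] is a sink. *)
  have [bE|bN0] := eqVneq b 0.
    apply: BeltAcyclic; apply: (acyclic_state_sink i k j c 0 a w1 w3 w2).
    + by rewrite bE in P; exact/acyclic_params_swap.
    + by move: E; rewrite bE mulr0z => /eigen_swap23.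
    + by move: cS => /coords_rev /coords_rot /coords_rot; rewrite bE oppr0 opprK.
  apply: BeltMiddle; exists i, j, k, a, b, c, w1, w2, w3; split=> //; first by split; lia.
  move: cS => /(coords_pass _ _ _ _ _ _ _ _ _ _ a0 b0) /coords_rev.
  by rewrite !opprK opprB opprK addrC.
- by apply: BeltAcyclic; exact: acyclic_state_sink cS.
Qed.

(** Mutating at [j] again returns to the belt. At an end vertex, a single arrow to [j] gives a
    pentagon leading to an acyclic or middle seed, and two or more start the growth. *)
Lemma middle_state_mut l S :
  middle_state S -> belt_tree (trop_mut_seed l S).
Proof.
move=> mS; have tS : belt_tree S by exact: BeltMiddle.
case: mS => [i [j [k [a [b [c [w1 [w2 [w3 [P [a0 b0] E cS]]]]]]]]]].
have u : uniq [:: k; j; i] by case: cS.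
have [[a0' b0' c0] _ CE] := P.
have W := acyclic_params_wild _ _ _ P a0 b0.
have m0 : 0 <= c + a * b by rewrite addr_ge0 ?mulr_ge0.
have cR : (0 : R) <= c%:~R by rewrite ler0z.
have bR : (b%:~R = 1 :> R) \/ (2 <= b%:~R :> R).
  have [->|bN1] := eqVneq b 1; [by left | right].
  by rewrite -[2]/(2%:~R) ler_int; lia.
have PW : [/\ 0 < w1, 0 < w2 & 0 < w3] by case: E.
have e0 : 0 < Num.max (a%:~R * w1) (b%:~R * w3) - w2.
  by rewrite subr_gt0; exact: eigen_mid_gt0 W E bR.
case: (ord3_cases k j i l u) => ->.
- move: cS => /coords_rot /coords_rot /(coords_pass _ _ _ _ _ _ _ _ _ _ m0 b0').
  move=> /coords_rev; rewrite !opprK opprB => cS.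
  have [b1|bN1] := eqVneq b 1.
    have bR1 : b%:~R = 1 :> R by rewrite b1.
    rewrite bR1 in E; rewrite b1 in P.
    have YE : Num.max ((c + a * b)%:~R * w1)
        (b%:~R * (Num.max (a%:~R * w1) (b%:~R * w3) - w2)) - w3 = L^-1 * w2.
      by rewrite intrD intrM bR1 mulr1 !mul1r; exact: pentagon_sink.
    have [q1 q2] : (c + a * b) * b - a = c /\ c + a * b = a + 1 * c by rewrite b1; lia.
    rewrite YE q1 q2 bR1 [1 * w3]mul1r b1 in cS.
    (* The multiplicity between [i] and [j] has become [c]: zero opens the cycle, otherwise this is
       a middle seed over another acyclic quiver of the belt. *)
    have [cz|cN0] := eqVneq c 0.
      rewrite cz mulr0z in E; rewrite cz in P.
      apply/BeltAcyclic/(acyclic_stateI j k i 1 a 0 (L^-1 * (L^-1 * w3)) (L^-1 * w2) w1).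
      + exact/acyclic_params_swap/acyclic_params_rot/acyclic_params_rot.
      + exact/eigen_sink/eigen_swap23/eigen_sink/eigen_sink.
      + by rewrite -(pentagon_sink_end _ _ _ _ _ L_gt0 E) oppr0; rewrite cz mulr0 addr0 in cS.
    apply: BeltMiddle; exists k, j, i, 1, c, a, (L^-1 * w2), (L^-1 * w3), w1; split.
    + exact: acyclic_params_rot.
    + by split; lia.
    + exact/eigen_sink/eigen_sink.
    + rewrite [1%:~R * _]mul1r (pentagon_sink_mid _ _ _ _ _ _ L_gt0 E).
      by move: cS => /coords_rot /coords_rot.
  have b2 : 2 <= b by lia.
  have b2R : 2 <= b%:~R :> R by rewrite -[2]/(2%:~R) ler_int.
  have := eigen_far3 _ _ _ _ _ _ _ W E b2R; rewrite -intrM -intrD /= => -[f1 f2].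
  apply: BeltFar tS _; exists i, j, (c + a * b), ((c + a * b) * b - a), b.
  move/coords_rot: cS => cS; do 3 eexists; split; last exact: cS.
    by have [? ? ? ?] := far_entries a b c a0 b2 c0; split.
  by case: PW => p1 _ p3; split.
- move: cS => /(coords_pass _ _ _ _ _ _ _ _ _ _ b0' a0') /coords_rev.
  have -> : - (c + a * b - b * a) = - c by lia.
  rewrite !opprK maxC => cS; apply: BeltAcyclic.
  apply: (acyclic_stateI _ _ _ _ _ _ _ _ _ _ P E).
  by rewrite subKr in cS; exact: cS.
- move: cS => /coords_rot /(coords_pass _ _ _ _ _ _ _ _ _ _ a0' m0).
  move=> /coords_rev /coords_rot; rewrite !opprK opprB => cS.
  have [a1|aN1] := eqVneq a 1.
    have aR1 : a%:~R = 1 :> R by rewrite a1.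
    rewrite aR1 in E; rewrite a1 in P.
    have XE : Num.max (a%:~R * (Num.max (a%:~R * w1) (b%:~R * w3) - w2))
        ((c + a * b)%:~R * w3) - w1 = L * w2.
      by rewrite intrD intrM aR1 !mul1r; exact: pentagon_source.
    have [q1 q2] : a * (c + a * b) - b = c /\ c + a * b = b + c * 1 by rewrite a1; lia.
    rewrite XE q1 q2 aR1 [1 * w1]mul1r a1 in cS.
    have [cz|cN0] := eqVneq c 0.
      rewrite cz mulr0z in E; rewrite cz in P.
      apply/BeltAcyclic/(acyclic_stateI k i j b 1 0 w3 (L * w2) (L * (L * w1))).
      + exact/acyclic_params_swap/acyclic_params_rot/acyclic_params_rot.
      + exact/eigen_source/eigen_swap12/eigen_source/eigen_source.
      + rewrite -(pentagon_source_end _ _ _ _ _ L_gt0 E) oppr0.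
        by rewrite cz mul0r addr0 in cS; move: cS => /coords_rot /coords_rot.
    apply: BeltMiddle; exists k, j, i, c, 1, b, w3, (L * w1), (L * w2); split.
    + exact/acyclic_params_rot/acyclic_params_rot.
    + by split; lia.
    + exact/eigen_source/eigen_source.
    + by rewrite [1%:~R * _]mul1r (pentagon_source_mid _ _ _ _ _ _ E).
  have a2 : 2 <= a by lia.
  have a2R : 2 <= a%:~R :> R by rewrite -[2]/(2%:~R) ler_int.
  have := eigen_far1 _ _ _ _ _ _ _ W E bR a2R; rewrite -intrM -intrD /= => -[f1 f2].
  apply: BeltFar tS _; exists j, k, a, (a * (c + a * b) - b), (c + a * b).
  do 3 eexists; split; last exact: cS.
    have := far_entries b a c b0 a2 c0.
    by rewrite /= [b * a]mulrC [_ * a]mulrC => -[? ? ? ?]; split.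
  by case: PW => p1 _ p3; split.
Qed.

(** The largest multiplicity and the largest value enter with a factor of at least 2, which
    outweighs what is subtracted; the pattern recurs at [l]. *)
Lemma far_state_mut r l S : l != r -> far_state r S ->
  far_state l (trop_mut_seed l S).
Proof.
move=> lr [s [t [x [y [z [X [Y [Z [[x2 z2 xy zy] [Y0 Z0 YX ZX] cS]]]]]]]]].
have u : uniq [:: r; s; t] by case: cS.
have x0 : 0 <= x by exact: le_trans x2.
have y0 : 0 <= y by exact: le_trans xy.
have z0 : 0 <= z by exact: le_trans z2.
have big (m : int) (U V : R) : 2 <= m -> 0 < U -> U <= X -> 0 <= V ->
    X <= Num.max V (m%:~R * X) - U.
  move=> m2 U0 UX V0; have : m%:~R * X <= Num.max V (m%:~R * X) by rewrite le_max lexx orbT.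
  have : 2 <= m%:~R :> R by rewrite -[2]/(2%:~R) ler_int.
  by nra.
case: (ord3_cases r s t l u) lr => ->; first by rewrite eqxx.
- move=> _; move: cS => /(coords_pass _ _ _ _ _ _ _ _ _ _ x0 y0) /coords_rev /coords_rot.
  rewrite !opprK opprB maxC => cS.
  have V0 : 0 <= y%:~R * Z by rewrite mulr_ge0 ?ler0z // ltW.
  have XX := big x Y (y%:~R * Z) x2 Y0 YX V0.
  exists r, t, x, (x * y - z), y; do 3 eexists; split; last exact: cS.
    exact: (far_entries_step x y z x2 z2 xy zy).
  by split=> //; [exact: lt_le_trans YX | exact: le_trans XX].
- move=> _; move: cS => /coords_rot /(coords_pass _ _ _ _ _ _ _ _ _ _ y0 z0) /coords_rev /coords_rot.
  rewrite !opprK opprB => cS.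
  have V0 : 0 <= y%:~R * Y by rewrite mulr_ge0 ?ler0z // ltW.
  have XX := big z Z (y%:~R * Y) z2 Z0 ZX V0.
  exists s, r, y, (y * z - x), z; do 3 eexists; split; last exact: cS.
    by have := far_entries_step z y x z2 x2 zy xy; rewrite mulrC => -[? ? ? ?]; split.
  by split=> //; [exact: lt_le_trans YX | exact: le_trans XX].
Qed.

Lemma belt_tree_skew S : belt_tree S -> skew3 S.1.
Proof.
elim=> {}S.
- by case=> [i [j [k [a [b [c [w1 [w2 [w3 [_ _ []]]]]]]]]]].
- by case=> [i [j [k [a [b [c [w1 [w2 [w3 [_ _ _ []]]]]]]]]]].
- by move=> T _ + _; exact: skew3_mut.
Qed.

(** At a far seed, mutating at the last vertex undoes the last step, and any other vertex leads
    further out. *)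
Lemma belt_tree_mut l S : belt_tree S -> belt_tree (trop_mut_seed l S).
Proof.
case=> {}S; [exact: acyclic_state_mut | exact: middle_state_mut |].
move=> T tT fT; have [->|lr] := eqVneq l S.
  by rewrite trop_mut_seedK //; exact: belt_tree_skew.
by apply: BeltFar; [exact: BeltFar | exact: far_state_mut fT].
Qed.

Lemma belt_tree_mut_seq s S : belt_tree S -> belt_tree (trop_mut_seq s S).
Proof. by elim: s S => //= k s IH S /(belt_tree_mut k) /IH. Qed.

Lemma belt_tree_gt0 S l : belt_tree S -> 0 < S.2 l.
Proof.
case=> {}S.
- case=> [i [j [k [a [b [c [w1 [w2 [w3 [_ [_ _ _ [? ? ?]] [u _ _ [E1 E2 E3]]]]]]]]]]]].
  by case: (ord3_cases i j k l u) => ->; rewrite ?E1 ?E2 ?E3.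
- case=> [i [j [k [a [b [c [w1 [w2 [w3 [P [a0 b0] E [u _ _ [E1 E2 E3]]]]]]]]]]]].
  have [p1 _ p3] : [/\ 0 < w1, 0 < w2 & 0 < w3] by case: E.
  have W := acyclic_params_wild _ _ _ P a0 b0.
  case: (ord3_cases k j i l u) => ->; rewrite ?E1 ?E2 ?E3 // subr_gt0.
  apply: eigen_mid_gt0 W E _.
  have [->|bN1] := eqVneq b 1; [by left | right].
  by rewrite -[2]/(2%:~R) ler_int; lia.
- move=> T _ [s [t [x [y [z [X [Y [Z [_ [Y0 Z0 YX ZX] [u _ _ [E1 E2 E3]]]]]]]]]]].
  by case: (ord3_cases S s t l u) => ->; rewrite ?E1 ?E2 ?E3 //; exact: lt_le_trans YX.
Qed.

End Positivity.

(** * Existence of the eigenvector and the source cycle *)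

Lemma eigen_solution {R : realFieldType} (L a b c : R) :
  5 / 2 <= L -> (1 + L) ^+ 2 = (a ^+ 2 + b ^+ 2 + c ^+ 2 + a * b * c) * L ->
  [/\ 0 <= a, 0 <= b & 0 <= c] ->
  [/\ 0 < a * b + c, 0 < a + b & 0 < b ^+ 2 + c ^+ 2 + a * b * c] ->
  exists w1 w2 w3, eigen L a b c w1 w2 w3.
Proof.
move=> L_ge L_eq [a0 b0 c0] [p1 p2 p3]; have L0 : 0 < L by lra.
(* The ratio found above dictates [w1] and [w3], and the second equation [w2]; the equation for [L]
   then yields the other two. *)
pose w1 := a * b + c + c * L.
pose w3 := L * (b ^+ 2 + c ^+ 2 + a * b * c).
have w1_gt0 : 0 < w1 by rewrite ltr_wpDr // mulr_ge0 // ltW.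
have w3_gt0 : 0 < w3 by rewrite mulr_gt0.
pose w2 := (b * w3 + a * L * w1) / (1 + L).
have L1 : 0 < 1 + L by lra.
have L1N : 1 + L != 0 by rewrite gt_eqF.
have e2 : (1 + L) * w2 = b * w3 + a * L * w1 by rewrite mulrC divfK.
have w2_gt0 : 0 < w2.
  rewrite divr_gt0 //; have aw : 0 <= a * L * w1 by rewrite !mulr_ge0 // ltW.
  have [bp|bN] := ltrP 0 b; first by rewrite ltr_wpDr // mulr_gt0.
  have bw : 0 <= b * w3 by rewrite mulr_ge0 // ltW.
  by rewrite ltr_wpDl // !mulr_gt0 //; lra.
have [w1E w3E] : w1 = a * b + c + c * L /\ w3 = L * (b ^+ 2 + c ^+ 2 + a * b * c) by [].
clearbody w1 w2 w3; exists w1, w2, w3; split=> //.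
- apply: (mulfI L1N); rewrite mulrA -expr2 L_eq mulrDr.
  have -> : (1 + L) * (a * w2) = a * (b * w3 + a * L * w1) by rewrite -e2; ring.
  by rewrite w1E w3E; ring.
- apply: (mulfI L1N); rewrite mulrA -expr2 L_eq mulrDr.
  have -> : (1 + L) * (b * L * w2) = b * L * (b * w3 + a * L * w1).
    by rewrite -e2; ring.
  have key : (c + c * L + a * b * L) * w1 = (a ^+ 2 + c ^+ 2 + a * b * c) * w3.
    have -> : (c + c * L + a * b * L) * w1 =
        (c ^+ 2 + a * b * c) * (1 + L) ^+ 2 + a ^+ 2 * b ^+ 2 * L by rewrite w1E; ring.
    by rewrite L_eq w3E; ring.
  have -> : (1 + L) * (c * L * w1) + b * L * (b * w3 + a * L * w1) =
      L * ((c + c * L + a * b * L) * w1) + L * (b ^+ 2 * w3) by ring.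
  by rewrite key; ring.
Qed.

Lemma eigen_exists {R : realFieldType} (C : int) (L : R) a b c :
  5 / 2 <= L -> (1 + L) ^+ 2 = C%:~R * L -> acyclic_params C a b c ->
  exists w1 w2 w3, eigen L a%:~R b%:~R c%:~R w1 w2 w3.
Proof.
move=> L_ge L_eq [[a0 b0 c0] [ab bc ac] CE]; apply: eigen_solution => //.
- by rewrite L_eq -CE !(intrD, rmorphXn, intrM).
- by rewrite !ler0z.
- rewrite -!rmorphXn -!intrM -!intrD !ltr0z; split=> //.
    by have [cz|cN] := eqVneq c 0; [have : 0 < a * b by nia | have := mulr_ge0 a0 b0]; lia.
  have abc := mulr_ge0 (mulr_ge0 a0 b0) c0; rewrite ltr_wpDr //.
  by have [bz|bN] := eqVneq b 0; [have : 0 < c by lia | have : 0 < b by lia]; nia.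
Qed.

Lemma trop_seed_ext {R : realFieldType} i j k p q r x y z
    (S T : 'M[int]_3 * ('I_3 -> R)) :
  coords i j k p q r x y z S -> coords i j k p q r x y z T -> S = T.
Proof.
case: S T => [B u] [B' u'] [un s /= [E1 E2 E3] [F1 F2 F3]] [_ s' /= [E1' E2' E3'] [F1' F2' F3']].
congr pair; last first.
  apply: functional_extensionality => l.
  by case: (ord3_cases i j k l un) => ->; rewrite ?F1 ?F2 ?F3 ?F1' ?F2' ?F3'.
apply/matrixP => l m.
have [G1 G2 G3] : [/\ B j i = - p, B k j = - q & B i k = - r].
  by rewrite (skew3E B j i) // (skew3E B k j) // (skew3E B i k) // E1 E2 E3.
have [G1' G2' G3'] : [/\ B' j i = - p, B' k j = - q & B' i k = - r].
  by rewrite (skew3E B' j i) // (skew3E B' k j) // (skew3E B' i k) // E1' E2' E3'.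
case: (ord3_cases i j k l un) => ->; case: (ord3_cases i j k m un) => ->;
  by rewrite ?skew3_diag // ?E1 ?E2 ?E3 ?G1 ?G2 ?G3 ?E1' ?E2' ?E3' ?G1' ?G2' ?G3'.
Qed.

Definition trop_seed_of {R : realFieldType} (B : 'M[int]_3) (i j k : 'I_3)
    (x y z : R) : 'M[int]_3 * ('I_3 -> R) :=
  (B, fun l => if l == i then x else if l == j then y else z).

Lemma coords_of {R : realFieldType} B i j k (x y z : R) :
  uniq [:: i; j; k] -> skew3 B ->
  coords i j k (B i j) (B j k) (B k i) x y z (trop_seed_of B i j k x y z).
Proof.
move=> u sB; split=> //=; move: u; rewrite /= !inE negb_or.
case/andP=> /andP [ij ik] /andP [jk _].
by rewrite eqxx eq_sym (negPf ij) eqxx eq_sym (negPf ik) eq_sym (negPf jk).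
Qed.

(** Three source mutations rotate the parameters back into place, each multiplying one value by
    [L]. *)
Lemma source_cycle {R : realFieldType} (C : int) (L : R) i j k a b c w1 w2 w3 B u :
  5 / 2 <= L -> (1 + L) ^+ 2 = C%:~R * L -> acyclic_params C a b c ->
  eigen L a%:~R b%:~R c%:~R w1 w2 w3 -> coords i j k a b (- c) w1 w2 w3 (B, u) ->
  trop_mut_seq [:: i; j; k] (B, u) = (B, fun l => L * u l).
Proof.
move=> L_ge L_eq P E cS.
have P2 := acyclic_params_rot _ _ _ _ P; have P3 := acyclic_params_rot _ _ _ _ P2.
have E2 := eigen_source _ _ _ _ _ _ _ L_ge E.
have E3 := eigen_source _ _ _ _ _ _ _ L_ge E2.
have c1 := acyclic_source _ _ _ _ _ _ _ _ _ _ _ _ P E cS.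
have c2 := acyclic_source _ _ _ _ _ _ _ _ _ _ _ _ P2 E2 c1.
have c3 := acyclic_source _ _ _ _ _ _ _ _ _ _ _ _ P3 E3 c2.
apply: trop_seed_ext c3 _.
by case: cS => un s Es [/= F1 F2 F3]; split=> //=; rewrite F1 F2 F3.
Qed.

Lemma gr_mut_source k (B : 'M[int]_3) g : (forall l, B l k <= 0) ->
  gr_mut k B g = fun l => if l == k then - g l else g l.
Proof.
move=> src; apply: functional_extensionality => l; rewrite /gr_mut.
by case: eqP => // ->; rewrite big1 ?addr0 // => i; rewrite ltNge src.
Qed.

Lemma source_col {R : realFieldType} i j k a b c w1 w2 w3
    (S : 'M[int]_3 * ('I_3 -> R)) :
  0 <= a -> 0 <= c -> coords i j k a b (- c) w1 w2 w3 S -> forall l, S.1 l i <= 0.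
Proof.
move=> a0 c0 [un s [E1 _ E3] _] l.
case: (ord3_cases i j k l un) => ->; first by rewrite skew3_diag.
  by rewrite (skew3E _ _ _ s) E1 oppr_le0.
by rewrite E3 oppr_le0.
Qed.

(** Each vertex is mutated exactly once and is a source at that moment, so its degree changes sign
    exactly once. *)
Lemma source_cycle_degree {R : realFieldType} (C : int) (L : R) i j k a b c
    w1 w2 w3 u S :
  5 / 2 <= L -> (1 + L) ^+ 2 = C%:~R * L -> acyclic_params C a b c ->
  eigen L a%:~R b%:~R c%:~R w1 w2 w3 -> coords i j k a b (- c) w1 w2 w3 (sB S, u) ->
  forall l, sg (mut_seed_seq [:: i; j; k] S) l = - sg S l.
Proof.
move=> L_ge L_eq P E cS.
have P2 := acyclic_params_rot _ _ _ _ P; have P3 := acyclic_params_rot _ _ _ _ P2.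
have E2 := eigen_source _ _ _ _ _ _ _ L_ge E.
have c1 := acyclic_source _ _ _ _ _ _ _ _ _ _ _ _ P E cS.
have c2 := acyclic_source _ _ _ _ _ _ _ _ _ _ _ _ P2 E2 c1.
have [[a0 b0 c0] _ _] := P.
have un : uniq [:: i; j; k] by case: cS.
have [ij ik jk] : [/\ i != j, i != k & j != k].
  by move: un; rewrite /= !inE negb_or => /andP [/andP [-> ->] /andP [->]].
have -> : sg (mut_seed_seq [:: i; j; k] S) =
    gr_mut k (mut_mx j (mut_mx i (sB S))) (gr_mut j (mut_mx i (sB S)) (gr_mut i (sB S) (sg S))).
  by [].
rewrite (gr_mut_source i); last exact: source_col a0 c0 cS.
rewrite (gr_mut_source j); last exact: source_col b0 a0 c1.
rewrite (gr_mut_source k); last exact: source_col c0 b0 c2.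
move=> l; case: (ord3_cases i j k l un) => ->.
- by rewrite (negPf ik) (negPf ij) eqxx.
- by rewrite (negPf jk) eqxx eq_sym (negPf ij).
- by rewrite eqxx eq_sym (negPf jk) eq_sym (negPf ik).
Qed.

(** The larger root of [L^2 - (C - 2) L + 1]: here [C - 2 >= 3] and the square root of the
    discriminant is at least 2, whence [5 / 2]. *)
Lemma coxeter_root (C : int) : 5 <= C ->
  exists L : realalg, 5 / 2 <= L /\ (1 + L) ^+ 2 = C%:~R * L.
Proof.
move=> C5; have C5' : (5 : realalg) <= C%:~R by rewrite -[5]/(5%:~R) ler_int.
set K : realalg := C%:~R - 2.
have D : 4 <= K ^+ 2 - 4 by rewrite /K; nra.
have s2 : Num.sqrt (K ^+ 2 - 4) ^+ 2 = K ^+ 2 - 4 by rewrite sqr_sqrtr; lra.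
have sge : 2 <= Num.sqrt (K ^+ 2 - 4).
  have -> : (2 : realalg) = Num.sqrt (2 ^+ 2) by rewrite sqrtr_sqr ger0_norm.
  by apply: ler_wsqrtr; rewrite -natrX.
exists ((K + Num.sqrt (K ^+ 2 - 4)) / 2); split; first by rewrite /K; lra.
have -> : C%:~R = K + 2 by rewrite /K; lra.
move: s2; set s := Num.sqrt _; move=> s2; rewrite /K in s2 *; nra.
Qed.

(** * Small mutation classes *)

Definition isolated (B : 'M[int]_3) (v : 'I_3) : Prop := forall j, B v j = 0.

(** Absence of isolated vertices is the form in which connectedness is carried along mutations. *)
Lemma isolated_mut k B v : isolated B v -> isolated (mut_mx k B) v.
Proof.
move=> iB j; rewrite mut_mxE !iB oppr0.
by case: ifP => // _; rewrite sgr0 mul0r addr0.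
Qed.

Lemma isolated_mut_seq s B v : isolated B v -> isolated (mut_seq s B) v.
Proof. by elim: s B => //= k s IH B /(isolated_mut k) /IH. Qed.

Lemma connected_not_isolated B v : quiver_connected B -> ~ isolated B v.
Proof.
move=> conn iB; pose j : 'I_3 := if v == ord0 then ord_max else ord0.
have /connectP [[|x p] /= pth e] := conn v j; last by rewrite iB eqxx in pth.
by move: e; rewrite /j; case: eqP => [->|vN] // e; case: vN.
Qed.

Lemma acyclic_order B : skew3 B -> acyclic B ->
  exists i j k, [/\ uniq [:: i; j; k], 0 <= B i j, 0 <= B j k & B k i <= 0].
Proof.
move=> sB aB.
have cyc (i j k : 'I_3) : 0 < B i j -> 0 < B j k -> 0 < B k i -> False.
  move=> p q r; apply: aB; exists i, j; split=> //.
  by apply: (@connect_trans _ _ k); exact: connect1.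
pose o : 'I_3 := Ordinal (isT : (1 < 3)%N); pose z : 'I_3 := ord0; pose t : 'I_3 := ord_max.
have [E1 E2 E3] : [/\ B o z = - B z o, B t o = - B o t & B z t = - B t z].
  by split; exact: skew3E.
have neg : B z o < 0 -> B o t < 0 -> B t z < 0 -> False.
  by move=> p q r; apply: (cyc z t o); rewrite ?E1 ?E2 ?E3 oppr_gt0.
have un : [/\ uniq [:: z; o; t], uniq [:: o; t; z] & uniq [:: t; z; o]] by [].
have un' : [/\ uniq [:: z; t; o], uniq [:: o; z; t] & uniq [:: t; o; z]] by [].
have := cyc z o t; move: un un' neg E1 E2 E3.
move=> [u1 u2 u3] [v1 v2 v3] neg E1 E2 E3 pos.
have [p|p] := leP (B z o) 0; have [q|q] := leP (B o t) 0; have [r|r] := leP (B t z) 0.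
(* All three entries are nonpositive: a zero entry allows a topological order, otherwise there is an
   oriented cycle. *)
- have [pz|pN] := eqVneq (B z o) 0.
    by exists z, t, o; rewrite E1 E2 E3; split=> //; lia.
  have [qz|qN] := eqVneq (B o t) 0.
    by exists o, z, t; rewrite E1 E2 E3; split=> //; lia.
  have [rz|rN] := eqVneq (B t z) 0.
    by exists t, o, z; rewrite E1 E2 E3; split=> //; lia.
  by case: neg; lia.
- by exists t, o, z; rewrite E1 E2 E3; split=> //; lia.
- by exists o, z, t; rewrite E1 E2 E3; split=> //; lia.
- by exists o, t, z; split=> //; lia.
- by exists z, t, o; rewrite E1 E2 E3; split=> //; lia.
- by exists t, z, o; split=> //; lia.
- by exists z, o, t; split=> //; lia.
- by case: pos; lia.
Qed.

Section SmallClasses.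

(* Markov constant at most 4: types A3 and affine A2, and the Markov quiver.
   A triple stands for the entries (B i j, B j k, B k i). *)
Definition small_triple (t : int * int * int) : bool :=
  let: (p, q, r) := t in
  let m := `|p * q * r| in
  let cyclic := [|| [&& 0 < p, 0 < q & 0 < r] | [&& p < 0, q < 0 & r < 0]] in
  [&& p ^+ 2 + q ^+ 2 + r ^+ 2 + (if cyclic then - m else m) <= 4,
      (p != 0) || (q != 0), (q != 0) || (r != 0) & (p != 0) || (r != 0)].

Definition small_ints : seq int := [:: -2; -1; 0; 1; 2].

Definition small_triples : seq (int * int * int) :=
  [seq t <- [seq (pq, r) | pq <- [seq (p, q) | p <- small_ints, q <- small_ints],
                         r <- small_ints] | small_triple t].

(** Mutation at the middle vertex; rotation reduces the other two vertices to it. *)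
Definition mut_triple (t : int * int * int) : int * int * int :=
  let: (p, q, r) := t in (- p, - q, r - Num.sg p * Num.max (p * q) 0).

Definition rot_triple (t : int * int * int) : int * int * int :=
  let: (p, q, r) := t in (q, r, p).

Lemma small_triples_mut : {in small_triples, forall t, mut_triple t \in small_triples}.
Proof. by apply/allP; vm_compute. Qed.

Lemma small_triples_rot : {in small_triples, forall t, rot_triple t \in small_triples}.
Proof. by apply/allP; vm_compute. Qed.

Lemma small_acyclic (a b c : int) : 0 <= a -> 0 <= b -> 0 <= c ->
  0 < a + b -> 0 < b + c -> 0 < a + c ->
  a ^+ 2 + b ^+ 2 + c ^+ 2 + a * b * c < 5 -> (a, b, - c) \in small_triples.
Proof.
move=> a0 b0 c0 ab bc ac C4.
have abc := mulr_ge0 (mulr_ge0 a0 b0) c0.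
have [a2 b2 c2] : [/\ a <= 2, b <= 2 & c <= 2] by split; nia.
have mem (x : int) : 0 <= x -> x <= 2 -> x \in [:: 0; 1; 2] by rewrite !inE; lia.
have check : all (fun t : int * int * int => let: (a, b, c) := t in
    [&& 0 < a + b, 0 < b + c, 0 < a + c & a ^+ 2 + b ^+ 2 + c ^+ 2 + a * b * c < 5]
      ==> ((a, b, - c) \in small_triples))
    [seq (ab, c) | ab <- [seq (a, b) | a <- [:: 0; 1; 2], b <- [:: 0; 1; 2]],
                   c <- [:: 0; 1; 2]] by vm_compute.
have /(allP check) : (a, b, c) \in [seq (ab, c) |
    ab <- [seq (a, b) | a <- [:: 0; 1; 2], b <- [:: 0; 1; 2]], c <- [:: 0; 1; 2]].
  by apply: allpairs_f; [apply: allpairs_f|]; exact: mem.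
by rewrite ab bc ac C4.
Qed.

Definition small_mx (i j k : 'I_3) (B : 'M[int]_3) : Prop :=
  [/\ uniq [:: i; j; k], skew3 B & (B i j, B j k, B k i) \in small_triples].

Lemma small_mx_rot i j k B : small_mx i j k B -> small_mx j k i B.
Proof.
case=> u sB t; split=> //; first by rewrite -(rot_uniq 1) in u.
exact: (small_triples_rot _ t).
Qed.

Lemma small_mx_mut_mid i j k B : small_mx i j k B -> small_mx i j k (mut_mx j B).
Proof.
case=> u sB /small_triples_mut t.
(* The zero tropical values are placeholders: only the mutated entries are read off. *)
have c := coords_mut _ _ _ _ _ _ _ _ _ _ (coords_of B i j k (0 : rat) 0 0 u sB).
by case: c => _ sB' /= [E1 E2 E3] _; split=> //; rewrite E1 E2 E3.
Qed.

Lemma small_mx_mut i j k l B : small_mx i j k B -> small_mx i j k (mut_mx l B).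
Proof.
move=> sm; have u : uniq [:: i; j; k] by case: sm.
case: (ord3_cases i j k l u) => ->.
- exact/small_mx_rot/small_mx_mut_mid/small_mx_rot/small_mx_rot.
- exact: small_mx_mut_mid.
- exact/small_mx_rot/small_mx_rot/small_mx_mut_mid/small_mx_rot.
Qed.

Lemma small_mx_mut_seq i j k s B : small_mx i j k B -> small_mx i j k (mut_seq s B).
Proof. by elim: s B => //= l s IH B /(small_mx_mut _ _ _ l) /IH. Qed.

Definition triple_mx (i j k : 'I_3) (t : int * int * int) : 'M[int]_3 :=
  let: (p, q, r) := t in
  \matrix_(x, y)
    if x == i then if y == j then p else if y == k then - r else 0
    else if x == j then if y == i then - p else if y == k then q else 0
    else if y == i then r else if y == j then - q else 0.

Lemma small_mx_mem i j k B : small_mx i j k B ->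
  B \in [seq triple_mx i j k t | t <- small_triples].
Proof.
case=> u sB t; apply/mapP; exists (B i j, B j k, B k i) => //.
have [ij ik jk] : [/\ i != j, i != k & j != k].
  by move: u; rewrite /= !inE negb_or => /andP [/andP [-> ->] /andP [->]].
have [ji ki kj] : [/\ j != i, k != i & k != j] by rewrite eq_sym ij eq_sym ik eq_sym jk.
apply/matrixP => x y; rewrite mxE.
case: (ord3_cases i j k x u) => ->; case: (ord3_cases i j k y u) => ->;
  rewrite ?eqxx ?(negPf ij) ?(negPf ik) ?(negPf jk) ?(negPf ji) ?(negPf ki)
    ?(negPf kj) ?skew3_diag //; exact: skew3E.
Qed.

Lemma small_mutation_finite i j k s B :
  small_mx i j k (mut_seq s B) -> ~ mutation_infinite B.
Proof.
move=> sm; apply; exists [seq triple_mx i j k t | t <- small_triples] => s'.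
(* Every matrix of the class is reached from the small one by first going back along [rev s]. *)
rewrite -(mut_seqK s B) -mut_seq_cat.
exact/small_mx_mem/small_mx_mut_seq.
Qed.

End SmallClasses.

Lemma wild_acyclic_params A : skew3 A -> quiver_connected A ->
  mutation_acyclic A -> mutation_infinite A ->
  exists s i j k a b c (C : int), [/\ 5 <= C, acyclic_params C a b c, uniq [:: i; j; k]
    & [/\ mut_seq s A i j = a, mut_seq s A j k = b & mut_seq s A k i = - c]].
Proof.
move=> sA conn [s acy] inf; set B := mut_seq s A in acy *.
have sB : skew3 B by exact: skew3_mut_seq.
have niso v : ~ isolated B v.
  move=> /(isolated_mut_seq (rev s)); rewrite mut_seqK.
  exact: connected_not_isolated.
have [i [j [k [u p q r]]]] := acyclic_order B sB acy.
have iso x y z : uniq [:: x; y; z] -> B x y = 0 -> B x z = 0 -> False.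
  move=> u' xy xz; apply: (niso x) => l.
  by case: (ord3_cases x y z l u') => ->; rewrite ?skew3_diag.
have u2 : uniq [:: j; k; i] by rewrite -(rot_uniq 1) in u.
have u3 : uniq [:: k; i; j] by rewrite -(rot_uniq 1) in u2.
have jiE := skew3E B j i sB; have kjE := skew3E B k j sB; have ikE := skew3E B i k sB.
(* A vanishing sum of these nonnegative entries would isolate [j]. *)
have ab : 0 < B i j + B j k.
  rewrite lt_def addr_ge0 // andbT; apply/eqP => e.
  by apply: (iso j k i u2); lia.
have bc : 0 < B j k + - B k i.
  rewrite lt_def addr_ge0 ?oppr_ge0 // andbT; apply/eqP => e.
  by apply: (iso k i j u3); lia.
have ac : 0 < B i j + - B k i.
  rewrite lt_def addr_ge0 ?oppr_ge0 // andbT; apply/eqP => e.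
  by apply: (iso i j k u); lia.
exists s, i, j, k, (B i j), (B j k), (- B k i).
exists (B i j ^+ 2 + B j k ^+ 2 + (- B k i) ^+ 2 + B i j * B j k * - B k i).
split=> //; last 2 first.
- by split=> //; split=> //; rewrite oppr_ge0.
- by rewrite opprK.
(* A constant below 5 would make the mutation class finite. *)
rewrite leNgt; apply/negP => small; case: (small_mutation_finite i j k s A _ inf).
split=> //; rewrite -/B -[B k i]opprK; apply: small_acyclic => //.
by rewrite oppr_ge0.
Qed.

(** * The expanding word *)

(** For a fixed matrix, degree mutation is linear. *)
Lemma sg_mut_seed_seqN s S T : sB T = sB S -> (forall l, sg T l = - sg S l) ->
  forall l, sg (mut_seed_seq s T) l = - sg (mut_seed_seq s S) l.
Proof.
elim: s S T => //= k s IH S T eB eg; apply: IH => /= [|l]; first by rewrite eB.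
rewrite eB; case: eqP => _; last exact: eg.
by rewrite eg opprD; congr (_ + _); rewrite -sumrN; apply: eq_bigr => i _; rewrite eg mulrN.
Qed.

(** The first two conditions give balance. The third supplies a weight that is positive on all
    cluster variables and stretched by the word. *)
Definition expanding (A : 'M[int]_3) (g : 'cV[int]_3) (sigma : seq 'I_3) : Prop :=
  [/\ mut_seq sigma A = A,
      forall l, sg (mut_seed_seq sigma (init_seed A g)) l = - g l ord0
    & exists (L : realalg) (u : 'I_3 -> realalg), [/\ 1 < L,
        trop_mut_seq sigma (A, u) = (A, fun l => L * u l)
      & forall s l, 0 < (trop_mut_seq s (A, u)).2 l]].

Lemma expanding_exists A g : skew3 A -> quiver_connected A ->
  mutation_acyclic A -> mutation_infinite A -> A *m g = 0 ->
  exists sigma, expanding A g sigma.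
Proof.
move=> sA conn acy inf Ag.
have [s [i [j [k [a [b [c [C [C5 P u [p q r]]]]]]]]]] := wild_acyclic_params A sA conn acy inf.
have [L [L_ge L_eq]] := coxeter_root C C5.
have [w1 [w2 [w3 E]]] := eigen_exists C L a b c L_ge L_eq P.
set B := mut_seq s A in p q r.
have sB' : skew3 B by exact: skew3_mut_seq.
have [w cS] : exists w, coords i j k a b (- c) w1 w2 w3 (B, w).
  by eexists; rewrite -p -q -r; exact: coords_of.
have cyc := source_cycle C L i j k a b c w1 w2 w3 B w L_ge L_eq P E cS.
have cycB : mut_seq [:: i; j; k] B = B.
  by have := congr1 fst cyc; rewrite trop_mut_seq1.
have tB : belt_tree C L (B, w).
  by apply/BeltAcyclic; exists i, j, k, a, b, c, w1, w2, w3.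
(* The eigenvector is transported from the belt back to [A]. *)
pose T := trop_mut_seq (rev s) (B, w).
have TA : T = (A, T.2).
  by rewrite [LHS]surjective_pairing; congr pair; rewrite trop_mut_seq1 mut_seqK.
have Ts : trop_mut_seq s T = (B, w).
  by rewrite /T -{1}[s]revK trop_mut_seqK.
have L1 : 1 < L by apply: lt_le_trans L_ge; lra.
(* The source cycle, conjugated by the path from [A] to the acyclic matrix. *)
exists (s ++ [:: i; j; k] ++ rev s); split.
- by rewrite !mut_seq_cat -/B cycB mut_seqK.
- move=> l; rewrite !mut_seed_seq_cat; set S := mut_seed_seq s _.
  have rI := regular_init_seed A g sA Ag.
  have SB : sB S = B by rewrite sB_mut_seed_seq.
  have -> : g l ord0 = sg (mut_seed_seq (rev s) S) l by rewrite mut_seed_seqK.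
  apply: sg_mut_seed_seqN => [|m].
    by rewrite sB_mut_seed_seq SB cycB.
  apply: (source_cycle_degree C L i j k a b c w1 w2 w3 w S L_ge L_eq P E).
  by rewrite SB.
- exists L, T.2; split=> // [|t l].
    rewrite -TA !trop_mut_seq_cat Ts cyc trop_mut_seq_scale; last by lra.
    by rewrite -/T TA.
  (* Every seed reachable from [T] is reachable from the belt seed, first along [rev s]. *)
  rewrite -TA; apply: (belt_tree_gt0 C L L_ge L_eq).
  by do 2 apply: (belt_tree_mut_seq C L L_ge L_eq).
Qed.

(** * Balance and infinitude from an expanding word *)

Section Main.
Variables (A : 'M[int]_3) (g : 'cV[int]_3) (sigma : seq 'I_3).
Hypotheses (sA : skew3 A) (Ag : A *m g = 0) (sigma_exp : expanding A g sigma).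

Local Notation S0 := (init_seed A g).
Local Notation clvar s k := (sx (mut_seed_seq s S0) k).
Local Notation cldeg s k := (sg (mut_seed_seq s S0) k).

Let S0_regular : regular_seed S0. Proof. exact: regular_init_seed. Qed.

Lemma cldeg_sigma s k : cldeg (sigma ++ s) k = - cldeg s k.
Proof.
case: sigma_exp => eA eg _; rewrite mut_seed_seq_cat; apply: sg_mut_seed_seqN => //.
by rewrite sB_mut_seed_seq.
Qed.

(** Prefixing [tau] amounts to substituting the cluster reached by [tau] for the initial one, so the
    result depends only on the rational function and not on the path to it. *)
Lemma clvar_subst tau s t k l : mut_seq tau A = A ->
  clvar s k = clvar t l -> clvar (tau ++ s) k = clvar (tau ++ t) l.
Proof.
move=> eA e.
pose v j := clvar tau j.
pose ev : {rmorphism {mpoly int[3]} -> {fraction {mpoly int[3]}}} := mmap intr v.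
have sub j : subst ev (sx S0 j) (sx (mut_seed_seq tau S0) j).
  have := subst_frac ev 'X_j; rewrite /ev /= mmapX mmap1U.
  by [].
have rT : regular_seed (mut_seed_seq tau S0) by exact: regular_seed_mut_seq.
have eB : sB S0 = sB (mut_seed_seq tau S0) by rewrite sB_mut_seed_seq.
have h := subst_mut_seed_seq ev _ S0 _ S0_regular rT eB sub.
rewrite !mut_seed_seq_cat.
by apply: (subst_unique ev) (h s k) _; rewrite e; exact: h.
Qed.

Lemma mut_seq_rev_sigma : mut_seq (rev sigma) A = A.
Proof. by case: sigma_exp => eA _ _; rewrite -{1}eA mut_seqK. Qed.

Lemma clvar_sigmaK s k : clvar (sigma ++ (rev sigma ++ s)) k = clvar s k.
Proof. by rewrite catA !mut_seed_seq_cat mut_seed_seqK. Qed.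

Lemma clvar_sigmaVK s k : clvar (rev sigma ++ (sigma ++ s)) k = clvar s k.
Proof.
have := mut_seed_seqK (rev sigma) S0 S0_regular; rewrite revK => h.
by rewrite !mut_seed_seq_cat h.
Qed.

Lemma balanced_main : balanced A g.
Proof.
move=> d; pose rel y z := exists s k, clvar s k = y /\ clvar (sigma ++ s) k = z.
have eA : mut_seq sigma A = A by case: sigma_exp.
(* The substitution along [sigma], restricted to cluster variables; [clvar_subst] shows that the
   choice is forced, and [rev sigma] provides the inverse. *)
pose f (y : F) : F := epsilon (inhabits y) (rel y).
have fE s k : f (clvar s k) = clvar (sigma ++ s) k.
  have [t [l [e <-]]] : rel (clvar s k) (f (clvar s k)).
    by apply: epsilon_spec; exists (clvar (sigma ++ s) k), s, k.
  exact: clvar_subst.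
exists f; split; [|split].
- move=> _ [s [k [<- <-]]]; exists (sigma ++ s), k.
  by rewrite fE cldeg_sigma.
- move=> _ _ [s [k [<- _]]] [t [l [<- _]]]; rewrite !fE => e.
  have := clvar_subst (rev sigma) _ _ _ _ mut_seq_rev_sigma e.
  by rewrite !clvar_sigmaVK.
- move=> _ [s [k [<- ds]]]; exists (clvar (rev sigma ++ s) k); split.
    exists (rev sigma ++ s), k; split=> //.
    have := cldeg_sigma (rev sigma ++ s) k.
    by rewrite catA mut_seed_seq_cat mut_seed_seq_cat mut_seed_seqK // ds => /oppr_inj.
  by rewrite fE clvar_sigmaK.
Qed.

Lemma infinite_main d : degree_occurs A g d -> infinitely_many_of_deg A g d.
Proof.
move=> [_ [s [k [_ ds]]]] l.
have [eA _ [L [u [L1 tsig tpos]]]] := sigma_exp.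
(* One copy of [sigma] negates the degree, so two are prepended each time. *)
pose word n := iter n (fun t => sigma ++ (sigma ++ t)) s.
have degw n : cldeg (word n) k = d.
  by elim: n => //= n IH; rewrite !cldeg_sigma opprK.
have tropw n : trop_mut_seq (word n) (A, u) =
    ((trop_mut_seq s (A, u)).1, fun j => L ^+ n.*2 * (trop_mut_seq s (A, u)).2 j).
  elim: n => [|n IH] /=.
    rewrite [LHS]surjective_pairing; congr pair.
    by apply: functional_extensionality => j; rewrite expr0 mul1r.
  have L0 : 0 <= L by lra.
  rewrite trop_mut_seq_cat tsig trop_mut_seq_scale // trop_mut_seq_cat tsig.
  rewrite trop_mut_seq_scale // IH /=; congr pair.
  by apply: functional_extensionality => j; rewrite !exprS !mulrA.
have tropy n : trop u (clvar (word n) k) (L ^+ n.*2 * (trop_mut_seq s (A, u)).2 k).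
  have := trop_mut_seqP u u (word n) S0 (fun j => tropX u j) k.
  by rewrite tropw.
have inj : injective (fun n => clvar (word n) k).
  move=> m n /= e; have := tropy m; rewrite e => /trop_unique /(_ (tropy n)).
  have L0 : 0 < L by lra.
  have L1N : L != 1 by rewrite gt_eqF.
  by move/(mulIf (lt0r_neq0 (tpos s k)))/(ieexprIn L0 L1N)/double_inj.
(* Pigeonhole: one more distinct variable than [l] has entries cannot all lie in [l]. *)
have [allin|/allPn [n _ nl]] :=
    boolP (all (fun n => clvar (word n) k \in l) (iota 0 (size l).+1)); last first.
  by exists (clvar (word n) k); split=> //; exists (word n), k.
have un : uniq [seq clvar (word n) k | n <- iota 0 (size l).+1].
  by rewrite map_inj_uniq ?iota_uniq.
have /(uniq_leq_size un) : {subset [seq clvar (word n) k | n <- iota 0 (size l).+1] <= l}.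
  by move=> _ /mapP [n nin ->]; exact: (allP allin).
by rewrite size_map size_iota ltnn.
Qed.
End Main.

Theorem mainTheorem2 (A : 'M[int]_3) (g : 'cV[int]_3) :
  skew3 A -> quiver_connected A -> mutation_acyclic A -> mutation_infinite A ->
  g != 0 -> A *m g = 0 ->
  (forall d : int, degree_occurs A g d -> infinitely_many_of_deg A g d) /\
  balanced A g.
Proof.
move=> sA conn acy inf _ Ag.
have [sigma e] := expanding_exists A g sA conn acy inf Ag.
by split=> [d|]; [exact: (infinite_main A g sigma) | exact: (balanced_main A g sigma)].
Qed.
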